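(* Let $1<c<3/2$. Let $\mathbf u=(\mathbf u(n))_{n\ge 0}$ be the sequence $\mathbf u(n)=\mathbf t_{\lfloor n^c\rfloor}$, where $\mathbf t$ is the Thue--Morse sequence. Then $\mathbf u$ is normal. More precisely, for any integer $L\geq 1$ there exist an exponent $\eta>0$ and a constant $C$ such that for all integers $N\ge 1$ and all $\omega=(\omega_0,\ldots,\omega_{L-1})\in\{0,1\}^L$ \[ \Bigl\lvert\bigl|\bigl\{0\le n<N:\bigl(\mathbf u(n),\mathbf u(n+1),\ldots,\mathbf u(n+L-1)\bigr)=\omega\bigr\}\bigr|-N/2^L\Bigr\rvert \leq CN^{1-\eta}. \]
   Context: For a nonnegative integer $n$, $s(n)$ denotes the binary sum-of-digits function, i.e. the number of $1$s in the binary expansion of $n$. The Thue--Morse sequence $\mathbf t=(\mathbf t_n)_{n\ge 0}$ is defined by $\mathbf t_n=0$ if $s(n)$ is even and $\mathbf t_n=1$ if $s(n)$ is odd. A sequence $\mathbf u$ with values in $\{0,1\}$ is normal if for every $L\ge1$ and every $\omega\in\{0,1\}^L$ the set of $n\ge 0$ such that $(\mathbf u(n),\ldots,\mathbf u(n+L-1))=\omega$ has asymptotic density $2^{-L}$. *)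

(* Defs.v *)
From HB Require Import structures.
From mathcomp Require Import all_boot all_order all_algebra.
From mathcomp Require Import all_classical all_reals all_analysis.
Import Order.TTheory GRing.Theory Num.Theory.
Import numFieldNormedType.Exports.

Set Implicit Arguments.
Unset Strict Implicit.
Unset Printing Implicit Defensive.

Local Open Scope classical_set_scope.
Local Open Scope ring_scope.

(* The binary digit of n of weight 2 ^ i is odd (n %/ 2 ^ i); it vanishes for
   i >= n because n < 2 ^ n, so the range i < n covers all nonzero digits. *)
Definition sum_of_digits2 (n : nat) : nat := (\sum_(i < n) odd (n %/ 2 ^ i))%N.

(* The letters 0 and 1 are false and true. *)
Definition thue_morse (n : nat) : bool := odd (sum_of_digits2 n).

Definition window (u : nat -> bool) (L n : nat) : L.-tuple bool :=
  [tuple u (n + i)%N | i < L].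

Definition count_below (A : pred nat) (N : nat) : nat := #|[pred n : 'I_N | A n]|.

Definition has_density (R : realType) (A : pred nat) (d : R) : Prop :=
  (fun N : nat => (count_below A N)%:R / N%:R : R) @ \oo --> d.

(* R only provides the real numbers in which the densities are taken. *)
Definition normal_seq (R : realType) (u : nat -> bool) : Prop :=
  forall L : nat, (1 <= L)%N -> forall w : L.-tuple bool,
    has_density (fun n => window u L n == w) ((2 ^+ L)^-1 : R).

(* On nonnegative reals Num.truncn is the floor function with values in nat. *)
Definition thue_morse_PS (R : realType) (c : R) (n : nat) : bool :=
  thue_morse (Num.truncn (n%:R `^ c)).

(* Main.v *)
(* Let s(n) be the sign (-1)^(t_n).  By expanding indicators of windows it is
   enough to save a power of N in sums of prod_{i in I} s([g(n + i)]), g(n) = n^c,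
   over n in [N, 2N), for every nonempty set I of shifts.

   Let q be a small power of N.  Cut the sum into blocks of q^2 consecutive n, on
   which g increases by about N^(c-1) q^2.  The binary digits of [g(n)] of weight
   at least 2^lam, of order N^(c-1) q^4, are constant on almost every block, and
   g is linear there up to a small error.  So a block sum is, up to
   sign, a function W of the pair (g(n) mod 2^lam, g(n+1) - g(n)) rounded to
   multiples of q^-4.  As second differences of g have order N^(c-2), the number
   of n with g(n+r) - g(n) near a multiple of 2^lam is easy to bound for each
   fixed r, and this shows that the pairs are equidistributed in mean square as
   soon as there are fewer cells than N, i.e. N^(2c-2) < N: this is where
   c < 3/2 is used.  By Cauchy-Schwarz it remains to bound the mean square of W
   over all cells (a, b), hence averages over b of |E_a prod_d phi(a + d b)|,
   where phi is the Thue-Morse sign of a window of binary digits.  These are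
   controlled by a Gowers norm of phi with a loss polynomial in the d's, that is,
   in q.  The Gowers norm itself decays like a power of 2^lam: splitting off
   blocks of digits, the state of the computation is a bounded family of carries,
   and from every state two blocks lead to the zero state with opposite signs. *)
Require Import Defs.
From HB Require Import structures.
From mathcomp Require Import all_boot all_order all_algebra.
From mathcomp Require Import all_classical all_reals all_analysis.
From mathcomp Require Import lra ring zify.
Import Order.TTheory GRing.Theory Num.Theory.
Import numFieldNormedType.Exports.

Set Implicit Arguments.
Unset Strict Implicit.
Unset Printing Implicit Defensive.

Local Open Scope ring_scope.

(** * Signs and carries of binary digits *)

Section DigitSigns.
Variables (R : realFieldType) (f : nat -> R).
(** These equations determine f as the sign (-1)^s(n) of the binary digit sum s(n); the Thue-Morse
    sign enters the analysis only through them. *)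
Hypotheses (f0 : f 0%N = 1) (fD : forall n, f n.*2 = f n)
  (fS : forall n, f n.*2.+1 = - f n).

Lemma sign_split k h l : (l < 2 ^ k)%N -> f (2 ^ k * h + l)%N = f h * f l.
Proof.
elim: k h l => [|k IHk] h l.
  by rewrite expn0 ltnS leqn0 => /eqP->; rewrite f0 mulr1 mul1n addn0.
move=> lk; have l2k : (l./2 < 2 ^ k)%N by rewrite expnS in lk; lia.
have -> : (2 ^ k.+1 * h + l = odd l + (2 ^ k * h + l./2).*2)%N.
  by rewrite -{1}(odd_double_half l) doubleD -[(2 ^ k * h).*2]mul2n mulnA -expnS addnCA.
rewrite -{3}(odd_double_half l).
by case: (odd l); rewrite ?add1n ?add0n ?fS ?fD IHk ?mulrN.
Qed.

Lemma sign_sqr n : f n ^+ 2 = 1.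
Proof.
elim/ltn_ind: n => n IHn; case: (posnP n) => [->|n0]; first by rewrite f0 expr1n.
have := odd_double_half n; case: (odd n) => <-.
  by rewrite add1n fS sqrrN IHn //; lia.
by rewrite add0n fD IHn //; lia.
Qed.

Lemma sign_norm n : `|f n| = 1.
Proof. by apply/eqP; rewrite -sqrp_eq1 // -normrX sign_sqr normr1. Qed.

Definition low_sign n z := f (z %% 2 ^ n)%N.

(** The T lowest digits of the sum come from e alone; only the carry e %/ 2 ^ T reaches the digits
    above. *)
Lemma low_sign_split T n z e :
  low_sign (T + n) (2 ^ T * z + e) = low_sign T e * low_sign n (z + e %/ 2 ^ T).
Proof.
rewrite /low_sign expnD.
have -> : ((2 ^ T * z + e) %% (2 ^ T * 2 ^ n)
  = 2 ^ T * ((z + e %/ 2 ^ T) %% 2 ^ n) + e %% 2 ^ T)%N.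
  rewrite {1}(divn_eq e (2 ^ T)) addnA [(_ %/ _ * _)%N]mulnC -mulnDr.
  have e2 : (e %% 2 ^ T < 2 ^ T)%N by rewrite ltn_mod expn_gt0.
  rewrite {1}(divn_eq (z + e %/ 2 ^ T) (2 ^ n)) mulnDr mulnCA -addnA.
  rewrite modnMDl modn_small //.
  have m2 : ((z + e %/ 2 ^ T) %% 2 ^ n < 2 ^ n)%N by rewrite ltn_mod expn_gt0.
  by nia.
by rewrite sign_split ?ltn_mod ?expn_gt0 // mulrC.
Qed.

Lemma low_sign_norm n z : `|low_sign n z| = 1.
Proof. exact: sign_norm. Qed.

(* The product of F (x + w . hs + c w) over the corners w of the cube. *)
Fixpoint cube (F : nat -> R) (c : bitseq -> nat) (hs : seq nat) (x : nat) : R :=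
  if hs is h :: hs' then
    cube F (fun w => c (false :: w)) hs' x * cube F (fun w => c (true :: w)) hs' (x + h)
  else F (x + c [::])%N.

(* The offsets c after the T lowest digits have been split off, where hs and x
   are the parts of the sides and of the base point below 2 ^ T. *)
Fixpoint carry (T : nat) (c : bitseq -> nat) (hs : seq nat) (x : nat) (w : bitseq) : nat :=
  match hs, w with
  | h :: hs', b :: w' =>
      carry T (fun u => c (b :: u)) hs' (if b then x + h else x)%N w'
  | [::], _ => (x + c [::]) %/ 2 ^ T
  | _, _ => 0
  end.

Lemma eq_cube F c c' hs x : c =1 c' -> cube F c hs x = cube F c' hs x.
Proof.
elim: hs c c' x => [|h hs IH] c c' x cc' /=; first by rewrite cc'.
by congr (_ * _); apply: IH => w.
Qed.

Definition shiftdig T (hs' hs0 : seq nat) :=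
  [seq (2 ^ T * p.1 + p.2)%N | p <- zip hs' hs0].

(** Reading the T lowest digits changes the state from c to the family of carries, so the cube
    factors into a low part and a high part with new offsets. *)
Lemma cube_split T n c hs' hs0 x' x0 : size hs' = size hs0 ->
  cube (low_sign (T + n)) c (shiftdig T hs' hs0) (2 ^ T * x' + x0) =
  cube (low_sign T) c hs0 x0 * cube (low_sign n) (carry T c hs0 x0) hs' x'.
Proof.
elim: hs0 hs' c x' x0 => [|h0 hs0 IH] [|h' hs'] c x' x0 //=.
  by move=> _; rewrite -addnA low_sign_split.
case=> szh; rewrite IH // (_ : 2 ^ T * x' + x0 + (2 ^ T * h' + h0) =
  2 ^ T * (x' + h') + (x0 + h0))%N; last by lia.
by rewrite IH // mulrACA.
Qed.

Lemma cube_norm F c hs x : (forall z, `|F z| = 1) -> `|cube F c hs x| = 1.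
Proof.
move=> F1; elim: hs c x => [|h hs IH] c x /=; first exact: F1.
by rewrite normrM !IH mulr1.
Qed.

Lemma carry_bound T c hs x w C : (forall u, c u <= C)%N ->
  (carry T c hs x w <= (x + sumn hs + C) %/ 2 ^ T)%N.
Proof.
elim: hs c x w => [|h hs IH] c x w cC /=.
  by rewrite addn0; apply: leq_div2r; rewrite leq_add2l.
case: w => [//|b w]; apply: leq_trans (IH _ _ _ _) _ => [u|]; first exact: cC.
by apply: leq_div2r; case: b; lia.
Qed.

(** The s + 1 low parts are at most 2 ^ T - 1 each, so with an offset at most s the total stays
    below (s + 1) * 2 ^ T. Carries therefore range over a bounded set that does not depend on T. *)
Lemma carry_le T c hs x w s : (forall u, c u <= s)%N -> size hs = s ->
  (x < 2 ^ T)%N -> all (fun h => h < 2 ^ T)%N hs -> (carry T c hs x w <= s)%N.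
Proof.
move=> cs szs xT hsT; apply: leq_trans (carry_bound _ _ _ _ cs) _.
have hsum : (sumn hs + size hs <= size hs * 2 ^ T)%N.
  elim: hs hsT {szs} => [//|h hs IH] /= /andP[h1 h2].
  by have := IH h2; rewrite mulSn; lia.
rewrite -ltnS ltn_divLR ?expn_gt0 //; rewrite szs in hsum.
by rewrite mulSn; lia.
Qed.

Fixpoint pows s : seq nat := if s is s'.+1 then (2 ^ s')%N :: pows s' else [::].

(** The subset sums of 2 ^ (s - 1), ..., 2, 1 take each value v < 2 ^ s exactly once. *)
Lemma cube_pows F s x : cube F (fun=> 0%N) (pows s) x = \prod_(0 <= v < 2 ^ s) F (x + v)%N.
Proof.
elim: s x => [|s IH] x /=; first by rewrite expn0 big_nat1.
rewrite !IH expnS mul2n -addnn [RHS](@big_cat_nat _ _ _ (2 ^ s)) ?leq_addr //=.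
congr (_ * _).
have := @big_addn R 1 *%R 0 (2 ^ s + 2 ^ s) (2 ^ s) xpredT (fun v => F (x + v)%N).
rewrite add0n addnK => ->.
by apply: eq_bigr => i _; rewrite -addnA [(_ + i)%N]addnC.
Qed.

(** Consecutive factors pair off to -1, and for s >= 2 the number 2 ^ (s - 1) of pairs is even. *)
Lemma prod_sign s : (2 <= s)%N -> \prod_(0 <= v < 2 ^ s) f v = 1.
Proof.
case: s => [//|[//|s]] _.
have H m : \prod_(0 <= v < m.*2) f v = (-1) ^+ m.
  elim: m => [|m IH]; first by rewrite big_nil expr0.
  rewrite doubleS !big_nat_recr //= IH fD fS mulrN -mulrA -expr2 sign_sqr.
  by rewrite mulr1 exprSr mulrN1.
by rewrite expnS mul2n H expnS exprM sqrrN !expr1n.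
Qed.

(* The corners 1 + v run over 1, ..., 2 ^ s; compared with 0, ..., 2 ^ s - 1
   the sign of 0 is replaced by the sign of 2 ^ s. *)
Lemma cube_flip s : (2 <= s)%N ->
  cube (low_sign s.+1) (fun=> 0%N) (pows s) 1 = -1.
Proof.
move=> s2; rewrite cube_pows.
have -> : \prod_(0 <= v < 2 ^ s) low_sign s.+1 (1 + v) = \prod_(0 <= v < 2 ^ s) f v.+1.
  rewrite big_nat_cond [RHS]big_nat_cond; apply: eq_bigr => v /andP[/andP[_ v2] _].
  rewrite /low_sign add1n modn_small // expnS.
  by have := expn_gt0 2 s; lia.
have : \prod_(0 <= v < (2 ^ s).+1) f v = f (2 ^ s)%N.
  by rewrite big_nat_recr //= prod_sign // mul1r.
rewrite big_nat_recl //= f0 mul1r => ->.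
have -> : (2 ^ s = 2 ^ s * 1 + 0)%N by rewrite muln1 addn0.
rewrite sign_split ?expn_gt0 // f0 mulr1.
by rewrite (_ : 1%N = 0.*2.+1) // fS f0.
Qed.

End DigitSigns.

(** * Cancellation in sums over all cubes of digit blocks *)

Fixpoint words k B : seq (seq nat) :=
  if k is k'.+1 then [seq h :: t | h <- iota 0 B, t <- words k' B] else [:: [::]].

Lemma mem_words k B t : (t \in words k B) = (size t == k) && all (fun h => h < B)%N t.
Proof.
elim: k t => [|k IH] t /=; first by rewrite inE; case: t.
apply/allpairsP/andP => [[[h u] /= [hB uw ->]]|].
  by move: hB uw; rewrite IH mem_iota /= add0n => -> /andP[/eqP-> ->].
case: t => [|h t] /= [] // st /andP[hB tB]; exists (h, t); split => //=.
  by rewrite mem_iota.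
by rewrite IH tB andbT.
Qed.

Lemma uniq_words k B : uniq (words k B).
Proof.
elim: k => [//|k IH] /=.
by apply: allpairs_uniq => //; [exact: iota_uniq | move=> [a b] [a' b'] _ _ /= [-> ->]].
Qed.

Lemma size_words k B : size (words k B) = (B ^ k)%N.
Proof. by elim: k => [//|k IH] /=; rewrite size_allpairs IH size_iota expnS. Qed.

Lemma big_words (R : nmodType) k B (G : seq nat -> R) :
  \sum_(t <- words k.+1 B) G t = \sum_(0 <= h < B) \sum_(t <- words k B) G (h :: t).
Proof. by rewrite /= big_allpairs_dep /index_iota subn0. Qed.

Lemma big_nat_divmod (R : nmodType) A B (G : nat -> R) :
  \sum_(0 <= h < A * B) G h = \sum_(0 <= h0 < A) \sum_(0 <= h' < B) G (A * h' + h0)%N.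
Proof.
rewrite exchange_big /=; elim: B => [|B IH]; first by rewrite muln0 !big_nil.
rewrite big_nat_recr //= -IH mulnS addnC (@big_cat_nat _ _ _ (A * B)) ?leq_addr //=.
congr (_ + _).
have := @big_addn R 0 +%R 0 (A * B + A) (A * B) xpredT G.
by rewrite add0n addKn => ->; apply: eq_bigr => i _; rewrite addnC.
Qed.

Lemma big_words_split (R : nmodType) k T n (G : seq nat -> R) :
  \sum_(t <- words k (2 ^ (T + n))) G t =
  \sum_(t0 <- words k (2 ^ T)) \sum_(t' <- words k (2 ^ n)) G (shiftdig T t' t0).
Proof.
elim: k G => [|k IH] G; first by rewrite /= !big_seq1.
rewrite !big_words expnD big_nat_divmod; apply: eq_bigr => h0 _.
under [RHS]eq_bigr => t0 _ do rewrite big_words.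
rewrite [RHS]exchange_big /=; apply: eq_bigr => h' _.
by rewrite -expnD IH.
Qed.

Section Contraction.
Variables (R : realFieldType) (f : nat -> R).
Hypotheses (f0 : f 0%N = 1) (fD : forall n, f n.*2 = f n)
  (fS : forall n, f n.*2.+1 = - f n).
Variable s : nat.
Hypothesis s2 : (2 <= s)%N.

(** A word of length s + 1 encodes a cube: its head is the base point, its tail the list of
    sides. *)
Definition cubew (F : nat -> R) c t := cube F c (behead t) (head 0%N t).
Definition carryw T c t := carry T c (behead t) (head 0%N t).

(** For the zero offset this is the 2 ^ s-th power of the Gowers U^s norm of [low_sign f n] modulo 2
    ^ n, without the normalisation; other offsets are the states met when digits are split off. *)
Definition cube_sum n c := \sum_(t <- words s.+1 (2 ^ n)) cubew (low_sign f n) c t.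

Lemma eq_cube_sum n c c' : c =1 c' -> cube_sum n c = cube_sum n c'.
Proof. by move=> cc; apply: eq_bigr => t _; apply: eq_cube. Qed.

Lemma cubew_norm T c t : `|cubew (low_sign f T) c t| = 1.
Proof. by apply: cube_norm => z; apply: low_sign_norm. Qed.

Lemma cube_sum_split T n c : cube_sum (T + n) c =
  \sum_(t <- words s.+1 (2 ^ T)) cubew (low_sign f T) c t * cube_sum n (carryw T c t).
Proof.
rewrite /cube_sum big_words_split big_seq [RHS]big_seq; apply: eq_bigr => t0.
rewrite mem_words => /andP[/eqP st0 _]; rewrite mulr_sumr big_seq [RHS]big_seq.
apply: eq_bigr => t'; rewrite mem_words => /andP[/eqP st' _].
case: t0 st0 => [//|x0 hs0] /= [sz0]; case: t' st' => [//|x' hs'] /= [sz'].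
by rewrite /cubew /carryw /= cube_split // sz0.
Qed.

Definition admissible (c : bitseq -> nat) := forall u, (c u <= s)%N.

Lemma admissible_carry T c t : admissible c -> t \in words s.+1 (2 ^ T) ->
  admissible (carryw T c t).
Proof.
move=> cs; rewrite mem_words => /andP[]; case: t => [//|x hs] /= /eqP[sz] /andP[xT hT] u.
exact: carry_le.
Qed.

Lemma cube_sum_trivial n c : `|cube_sum n c| <= (2 ^ n)%:R ^+ s.+1.
Proof.
apply: le_trans (ler_norm_sum _ _ _) _.
under eq_bigr => t _ do rewrite cubew_norm.
by rewrite big_const_seq count_predT size_words iter_addr_0 -natrX lexx.
Qed.

Lemma cube_sum_le T n b : (forall c, admissible c -> `|cube_sum n c| <= b) ->
  forall c, admissible c -> `|cube_sum (T + n) c| <= (2 ^ T)%:R ^+ s.+1 * b.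
Proof.
move=> Hb c cs; rewrite cube_sum_split; apply: le_trans (ler_norm_sum _ _ _) _.
apply: le_trans (_ : \sum_(t <- words s.+1 (2 ^ T)) b <= _).
  rewrite big_seq [leRHS]big_seq; apply: ler_sum => t tw.
  by rewrite normrM cubew_norm mul1r; apply: Hb; apply: admissible_carry.
by rewrite big_const_seq count_predT size_words iter_addr_0 -natrX mulr_natl.
Qed.

Lemma sumn_pows m : sumn (pows m) = (2 ^ m).-1.
Proof. by elim: m => [//|m IH] /=; rewrite IH expnS; have := expn_gt0 2 m; lia. Qed.

Lemma size_pows m : size (pows m) = m.
Proof. by elim: m => [//|m IH] /=; rewrite IH. Qed.

Lemma all_pows m : all (fun h => h < 2 ^ m.+1)%N (pows m).
Proof.
suff H k : (k <= m)%N -> all (fun h => h < 2 ^ m.+1)%N (pows k) by exact: H.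
elim: k => [//|k IH] km /=; rewrite IH ?(ltnW km) // andbT.
by rewrite ltn_exp2l // ltnS ltnW.
Qed.

Lemma cubew_zero T m : cube (low_sign f T) (fun=> 0%N) (nseq m 0%N) 0 = 1.
Proof. by elim: m => [|m IH] /=; rewrite ?addn0 ?IH ?mulr1 // /low_sign mod0n. Qed.

Lemma carry_zero T m c : (forall u, c u < 2 ^ T)%N -> carry T c (nseq m 0%N) 0 =1 fun=> 0%N.
Proof.
move=> cT u; apply/eqP; rewrite -leqn0.
have c' v : (c v <= (2 ^ T).-1)%N by have := cT v; lia.
apply: leq_trans (carry_bound _ _ _ _ c') _.
by rewrite sumn_nseq mul0n !add0n divn_small // prednK ?expn_gt0.
Qed.

Lemma carry_pows m : carry m.+1 (fun=> 0%N) (pows m) 1 =1 fun=> 0%N.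
Proof.
move=> u; apply/eqP; rewrite -leqn0.
apply: leq_trans (carry_bound _ _ _ _ (_ : forall v, 0 <= 0)%N) _ => //.
rewrite sumn_pows addn0 divn_small // add1n prednK ?expn_gt0 //.
by rewrite ltn_exp2l.
Qed.

(* The blocks 0 and (1, 2 ^ (s - 1), ..., 1) leave no carry but have opposite signs. *)
Lemma cube_sum_cancel n b : (forall c, admissible c -> `|cube_sum n c| <= b) ->
  `|cube_sum (s.+1 + n) (fun=> 0%N)| <= ((2 ^ s.+1)%:R ^+ s.+1 - 2) * b.
Proof.
move=> Hb; rewrite cube_sum_split.
pose A := nseq s.+1 0%N; pose B := 1%N :: pows s.
have szA : A \in words s.+1 (2 ^ s.+1).
  by rewrite mem_words size_nseq eqxx all_nseq expn_gt0 orbT.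
have szB : B \in words s.+1 (2 ^ s.+1).
  by rewrite mem_words /= size_pows eqxx all_pows andbT -{1}(expn0 2) ltn_exp2l.
have AB : B != A by [].
have mB : B \in [seq t <- words s.+1 (2 ^ s.+1) | t != A] by rewrite mem_filter AB.
have uB : uniq [seq t <- words s.+1 (2 ^ s.+1) | t != A] by rewrite filter_uniq ?uniq_words.
rewrite (bigD1_seq A) ?uniq_words //= -big_filter (bigD1_seq B) //=.
rewrite /cubew /= cubew_zero cube_flip // mul1r mulN1r.
rewrite (eq_cube_sum _ (_ : carryw _ _ A =1 fun=> 0%N)); last first.
  by apply: (@carry_zero s.+1 s) => u; rewrite expn_gt0.
rewrite (eq_cube_sum _ (_ : carryw _ _ B =1 fun=> 0%N)); last exact: carry_pows.
rewrite addrA subrr add0r; apply: le_trans (ler_norm_sum _ _ _) _.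
rewrite big_filter_cond.
apply: le_trans (_ : \sum_(t <- words s.+1 (2 ^ s.+1) | (t != A) && (t != B)) b <= _).
  rewrite big_seq_cond [leRHS]big_seq_cond; apply: ler_sum => t /andP[tw _].
  rewrite normrM cubew_norm mul1r; apply: Hb; apply: admissible_carry => //.
rewrite -[leLHS](addKr (b + b)).
have : \sum_(t <- words s.+1 (2 ^ s.+1)) b = (2 ^ s.+1)%:R ^+ s.+1 * b.
  by rewrite big_const_seq count_predT size_words iter_addr_0 -natrX mulr_natl.
rewrite (bigD1_seq A) ?uniq_words //= -big_filter (bigD1_seq B) //=.
by rewrite big_filter_cond => H; rewrite mulrBl -H mulr2n mulrDl mul1r; lra.
Qed.

Variable w : nat.
Hypothesis sw : (s < 2 ^ w)%N.
Let T := (w + s.+1)%N.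

(** A block of w zero digits absorbs every admissible offset, since s < 2 ^ w, and leads to the zero
    state; there the next s + 1 digits offer the two cancelling blocks. All other blocks are
    estimated trivially, so 2 of the (2 ^ T) ^ (s + 1) blocks are saved. *)
Lemma cube_sum_contract n b : (forall c, admissible c -> `|cube_sum n c| <= b) ->
  forall c, admissible c -> `|cube_sum (T + n) c| <= ((2 ^ T)%:R ^+ s.+1 - 2) * b.
Proof.
move=> Hb c cs; rewrite -addnA cube_sum_split.
pose A := nseq s.+1 0%N.
have szA : A \in words s.+1 (2 ^ w).
  by rewrite mem_words size_nseq eqxx all_nseq expn_gt0 orbT.
pose D := (2 ^ s.+1)%:R ^+ s.+1 * b.
have DE : \sum_(t <- words s.+1 (2 ^ w)) D = (2 ^ w)%:R ^+ s.+1 * D.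
  by rewrite big_const_seq count_predT size_words iter_addr_0 -natrX mulr_natl.
have -> : ((2 ^ T)%:R ^+ s.+1 - 2) * b = (2 ^ w)%:R ^+ s.+1 * D - 2 * b.
  by rewrite /T /D expnD natrM exprMn; ring.
rewrite -DE !(bigD1_seq A) ?uniq_words //= addrAC.
apply: le_trans (ler_normD _ _) _; apply: lerD.
  rewrite normrM cubew_norm mul1r.
  rewrite (eq_cube_sum _ (_ : carryw _ _ A =1 fun=> 0%N)); last first.
    by apply: (@carry_zero w s) => u; apply: leq_ltn_trans (cs u) sw.
  by rewrite /D -mulrBl; exact: cube_sum_cancel.
apply: le_trans (ler_norm_sum _ _ _) _.
rewrite big_seq_cond [leRHS]big_seq_cond; apply: ler_sum => t /andP[tw _].
rewrite normrM cubew_norm mul1r; apply: cube_sum_le => //.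
exact: admissible_carry.
Qed.

Lemma cube_sum_decay m n c : admissible c ->
  `|cube_sum (T * m + n) c| <= ((2 ^ T)%:R ^+ s.+1 - 2) ^+ m * (2 ^ n)%:R ^+ s.+1.
Proof.
elim: m c => [|m IH] c cs.
  by rewrite muln0 add0n expr0 mul1r cube_sum_trivial.
by rewrite mulnS -addnA exprS -mulrA; apply: cube_sum_contract.
Qed.

End Contraction.

(** Later 2 ^ rho is the small power q of N. The losses to be beaten are powers of q, hence the free
    exponent a, paid for by a number of digits proportional to rho. *)
Lemma cube_sum_power_saving (R : archiRealFieldType) (f : nat -> R) (s a : nat) :
  f 0%N = 1 -> (forall n, f n.*2 = f n) -> (forall n, f n.*2.+1 = - f n) ->
  (2 <= s)%N ->
  exists B : nat, forall rho lam c, (B * rho <= lam)%N -> admissible s c ->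
   `|cube_sum f s lam c| <= (2 ^ lam)%:R ^+ s.+1 * (2 ^+ (a * rho))^-1.
Proof.
move=> f0 fD fS s2.
have sw : (s < 2 ^ s)%N by exact: ltn_expl.
set T := (s + s.+1)%N; set X : R := (2 ^ T)%:R ^+ s.+1.
have X2 : 2 < X.
  rewrite /X -natrX -expnM ltr_nat -[X in (X < _)%N](expn1 2) ltn_exp2l // /T; nia.
have X0 : 0 < X by lra.
(* Bernoulli's inequality gives 2 ^ a <= (1 + 2 / X) ^ e for large e, and (X - 2) * (1 + 2 / X) <= X
   turns this into a saving of 2 ^ a in e rounds of contraction. *)
have [e he] : exists e, (X - 2) ^+ e * 2 ^+ a <= X ^+ e.
  have [e he] : exists e : nat, X * 2 ^+ a <= e%:R.
    by exists (Num.truncn (X * 2 ^+ a)).+1; apply/ltW/truncnS_gt.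
  have hb : 1 + e%:R * (2 / X) <= (1 + 2 / X) ^+ e.
    elim: {he} e => [|e IH]; first by rewrite mul0r addr0 expr0.
    have z0 : 0 <= 2 / X by rewrite divr_ge0 // ltW.
    rewrite exprS -natr1; move: (2 / X) z0 IH => z z0 IH.
    have z1 : 0 <= 1 + z by lra.
    apply: le_trans (ler_wpM2l z1 IH).
    have : 0 <= z * z * e%:R by rewrite !mulr_ge0.
    by lra.
  exists e; have a2 : 2 ^+ a <= (1 + 2 / X) ^+ e.
    apply: le_trans hb; have : 2 ^+ a <= e%:R / X by rewrite ler_pdivlMr // mulrC.
    have : 0 <= e%:R / X by rewrite divr_ge0 // ltW.
    by rewrite (mulrCA e%:R); move: (e%:R / X) => *; lra.
  apply: le_trans (ler_wpM2l (exprn_ge0 _ _) a2) _; first by lra.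
  have z0 : 0 <= 2 / X by rewrite divr_ge0 // ltW.
  rewrite -exprMn; apply: lerXn2r; rewrite ?nnegrE ?(ltW X0) //.
    by apply: mulr_ge0; lra.
  have -> : (X - 2) * (1 + 2 / X) = X - 4 / X by field; lra.
  by rewrite lerBlDr lerDl divr_ge0 // ltW.
exists (T * e)%N => rho lam c hlam cs.
have := cube_sum_decay f0 fD fS s2 sw (e * rho) (lam - T * (e * rho)) cs.
rewrite -/T subnKC ?mulnA // => /le_trans; apply.
rewrite -/X ler_pdivlMr ?exprn_gt0 // mulrAC.
have -> : (2 ^ lam)%:R ^+ s.+1 = X ^+ (e * rho) * (2 ^ (lam - T * e * rho))%:R ^+ s.+1 :> R.
  rewrite /X -exprM [(_ * (e * rho))%N]mulnC exprM -exprMn; congr (_ ^+ _).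
  by rewrite -natrX -natrM -expnM -expnD mulnA subnKC.
rewrite ler_wpM2r ?exprn_ge0 // !exprM -exprMn lerXn2r // nnegrE.
  by rewrite mulr_ge0 ?exprn_ge0 //; lra.
by rewrite exprn_ge0 // ltW.
Qed.

(** * Linear forms and Gowers norms *)

Section Averages.
Variables (R : realFieldType) (Z : finComNzRingType).
Implicit Types (F G f : Z -> R) (x h d : Z).

Definition average F : R := #|Z|%:R^-1 * \sum_x F x.

Lemma card_gt0R : 0 < #|Z|%:R :> R.
Proof. by rewrite ltr0n; apply/card_gt0P; exists 0. Qed.

Lemma eq_avg F G : F =1 G -> average F = average G.
Proof. by move=> FG; congr (_ * _); apply: eq_bigr => x _. Qed.

Lemma le_avg F G : (forall x, F x <= G x) -> average F <= average G.
Proof. by move=> FG; rewrite ler_wpM2l ?invr_ge0 ?ler0n //; apply: ler_sum. Qed.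

Lemma avg_cst (a : R) : average (fun=> a) = a.
Proof. by rewrite /average sumr_const -(mulr_natl a) mulKf ?gt_eqF ?card_gt0R. Qed.

Lemma avg_ge0 F : (forall x, 0 <= F x) -> 0 <= average F.
Proof. by move=> F0; rewrite -(avg_cst 0); apply: le_avg. Qed.

Lemma avgZl (a : R) F : average (fun x => a * F x) = a * average F.
Proof. by rewrite /average -mulr_sumr mulrCA. Qed.

Lemma avg_shift F h : average (fun x => F (x + h)) = average F.
Proof. by rewrite /average; congr (_ * _); rewrite [RHS](reindex_inj (addIr h)). Qed.

Lemma avg_exchange (F : Z -> Z -> R) :
  average (fun x => average (F x)) = average (fun y => average (fun x => F x y)).
Proof. by rewrite /average -!mulr_sumr exchange_big. Qed.

Lemma avg_mul F G : average F * average G = average (fun x => average (fun h => F x * G (x + h))).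
Proof.
rewrite mulrC -avgZl; apply: eq_avg => x; rewrite avgZl mulrC; congr (_ * _).
by rewrite -(avg_shift G x); apply: eq_avg => h; rewrite addrC.
Qed.

Lemma avg_sqr_le F : average F ^+ 2 <= average (fun x => F x ^+ 2).
Proof.
rewrite -subr_ge0.
have -> : average (fun x => F x ^+ 2) - average F ^+ 2 = average (fun x => (F x - average F) ^+ 2).
  have -> : average (fun x => (F x - average F) ^+ 2) =
     average (fun x => F x ^+ 2) + average (fun x => (- 2 * average F) * F x) + average (fun=> average F ^+ 2).
    rewrite /average -!mulrDr -!big_split /=; congr (_ * _); apply: eq_bigr => x _.
    by rewrite sqrrB; ring.
  by rewrite avgZl avg_cst; ring.
by apply: avg_ge0 => x; apply: sqr_ge0.
Qed.

Lemma avg_pow2_le n F : (forall x, 0 <= F x) ->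
  average F ^+ (2 ^ n) <= average (fun x => F x ^+ (2 ^ n)).
Proof.
elim: n F => [|n IH] F F0; first by rewrite expn0 expr1; apply: le_avg => x; rewrite expr1.
rewrite expnS exprM; apply: le_trans (_ : average (fun x => F x ^+ 2) ^+ (2 ^ n) <= _).
  by apply: lerXn2r (avg_sqr_le F); rewrite nnegrE ?sqr_ge0 ?avg_ge0 // => x; rewrite sqr_ge0.
apply: le_trans (IH _ _) _ => [x|]; first exact: sqr_ge0.
by apply: le_avg => x; rewrite exprM.
Qed.

Definition mult_diff f h := fun x => f x * f (x + h).

(* cubeU k f is the 2 ^ k-th power of the Gowers U^k norm of f. *)
Fixpoint cubeN k f : R := if k is k'.+1 then average (fun h => cubeN k' (mult_diff f h)) else `|average f|.
Fixpoint cubeU k f : R := if k is k'.+1 then average (fun h => cubeU k' (mult_diff f h)) else average f.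

Lemma cubeN_ge0 k f : 0 <= cubeN k f.
Proof. by elim: k f => [|k IH] f /=; [exact: normr_ge0 | apply: avg_ge0]. Qed.

Lemma eq_cubeU k f f' : f =1 f' -> cubeU k f = cubeU k f'.
Proof.
elim: k f f' => [|k IH] f f' ff' /=; first exact: eq_avg.
by apply: eq_avg => h; apply: IH => x; rewrite /mult_diff !ff'.
Qed.

(** At the innermost level the square of the average is an average of f x * f (x + h), that is, one
    more difference; Cauchy-Schwarz carries the square through the outer averages. *)
Lemma cubeN_sqr k f : cubeN k f ^+ 2 <= cubeU k.+1 f.
Proof.
elim: k f => [|k IH] f.
  rewrite /= real_normK ?num_real // expr2 avg_mul avg_exchange.
  by [].
apply: le_trans (avg_sqr_le _) _; apply: le_avg => h; exact: IH.
Qed.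

(** Equivalent to every fibre of h |-> d * h having at most K elements, stated with test functions
    as the averaging argument needs it. *)
Definition fiber_bounded (K : R) d :=
  forall F, (forall x, 0 <= F x) -> average (fun h => F (d * h)) <= K * average F.

Definition forms_average (fs : seq ((Z -> R) * Z)) f d :=
  average (fun b => `|average (fun a => f (a + d * b) * \prod_(p <- fs) p.1 (a + p.2 * b))|).

Definition forms_diff d0 h (fs : seq ((Z -> R) * Z)) :=
  [seq (mult_diff p.1 ((p.2 - d0) * h), p.2) | p <- fs].

Lemma forms_ge0 fs f d : 0 <= forms_average fs f d.
Proof. by apply: avg_ge0. Qed.

(** One Cauchy-Schwarz step, removing the form of [f0]. Signs [e b] replace the absolute values, the
    substitution a - d0 * b frees the argument of [f0] from b, and the squared average over b is
    expanded over pairs (b, b + h). *)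
Lemma forms_sqr f0 d0 fs f d : (forall x, `|f0 x| <= 1) ->
  forms_average ((f0, d0) :: fs) f d ^+ 2 <=
  average (fun h => forms_average (forms_diff d0 h fs) (mult_diff f ((d - d0) * h)) d).
Proof.
move=> f01; pose G b a := f (a + d * b) * \prod_(p <- fs) p.1 (a + p.2 * b).
pose e b := Num.sg (average (fun a => f (a + d * b) * \prod_(p <- (f0, d0) :: fs) p.1 (a + p.2 * b))).
pose X a := average (fun b => e b * G b (a - d0 * b)).
have e1 b : `|e b| <= 1 by rewrite /e normr_sg; case: (_ != 0).
have -> : forms_average ((f0, d0) :: fs) f d = average (fun a => f0 a * X a).
  rewrite /X; under [RHS]eq_avg => a do rewrite -avgZl.
  rewrite avg_exchange; apply: eq_avg => b; rewrite normrEsg -/(e b) -avgZl.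
  rewrite -(avg_shift _ (- (d0 * b))); apply: eq_avg => a.
  by rewrite big_cons /= subrK /G [f _ * (f0 a * _)]mulrCA [LHS]mulrCA.
apply: le_trans (avg_sqr_le _) _.
apply: le_trans (_ : average (fun a => X a ^+ 2) <= _).
  apply: le_avg => a; rewrite exprMn ler_piMl ?sqr_ge0 //.
  by rewrite -real_normK ?num_real // expr_le1.
have -> : average (fun a => X a ^+ 2) = average (fun h => average (fun b => e b * e (b + h) *
    average (fun a => G b a * G (b + h) (a - d0 * h)))).
  under eq_avg => a do rewrite expr2 /X avg_mul.
  rewrite avg_exchange; under eq_avg => b do rewrite avg_exchange.
  rewrite avg_exchange; apply: eq_avg => h; apply: eq_avg => b.
  rewrite -avgZl -(avg_shift _ (d0 * b)); apply: eq_avg => a.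
  rewrite addrK mulrDr opprD addrA addrK; ring.
apply: le_avg => h; apply: le_avg => b.
have -> : average (fun a => G b a * G (b + h) (a - d0 * h)) =
   average (fun a => mult_diff f ((d - d0) * h) (a + d * b) *
                 \prod_(p <- forms_diff d0 h fs) p.1 (a + p.2 * b)).
  apply: eq_avg => a; rewrite /G big_map /mult_diff mulrACA big_split /=.
  congr (_ * f _ * (_ * _)); first by ring.
  by apply: eq_bigr => p _; congr (p.1 _); ring.
by apply: le_trans (ler_norm _) _; rewrite 2!normrM ler_piMl ?normr_ge0 // mulr_ile1.
Qed.

Definition bounded1 (fs : seq ((Z -> R) * Z)) :=
  foldr (fun p P => (forall x, `|p.1 x| <= 1) /\ P) True fs.
Definition fibers_bounded K d (fs : seq ((Z -> R) * Z)) :=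
  foldr (fun p P => fiber_bounded K (d - p.2) /\ P) True fs.

Lemma bounded1_diffs d0 h fs : bounded1 fs -> bounded1 (forms_diff d0 h fs).
Proof.
elim: fs => [//|p fs IH] /= [p1 b1]; split; last exact: IH.
by move=> x; rewrite /mult_diff normrM mulr_ile1.
Qed.

Lemma fibers_diffs K d d0 h fs : fibers_bounded K d fs -> fibers_bounded K d (forms_diff d0 h fs).
Proof. by elim: fs => [//|p fs IH] /= [p1 b1]; split; last exact: IH. Qed.

(** Each elimination replaces f by its multiplicative difference with step (d - d0) * h; the fibre
    bound allows h itself as the step at the cost of a factor K. When f is the only form left, a
    shift of a removes b. *)
Lemma forms_le_cubeN (K : R) fs f d : 0 <= K -> bounded1 fs -> fibers_bounded K d fs ->
  forms_average fs f d ^+ (2 ^ size fs) <= K ^+ size fs * cubeN (size fs) f.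
Proof.
move=> K0; have [n szn] : {n | size fs = n} by exists (size fs).
elim: n fs szn f => [|n IH] [//|[f0 d0] fs] //= szn f.
  move=> _ _; rewrite expn0 expr1 mul1r -(avg_cst `|average f|); apply: le_avg => b.
  under eq_avg => a do rewrite big_nil mulr1.
  by rewrite avg_shift.
case: szn => szn [f01 b1] [fb Fb]; rewrite expnS exprM.
set A := average (fun h => forms_average (forms_diff d0 h fs) (mult_diff f ((d - d0) * h)) d).
apply: le_trans (_ : A ^+ (2 ^ size fs) <= _).
  by apply: lerXn2r (forms_sqr _ _ _ _ f01); rewrite nnegrE ?sqr_ge0 ?avg_ge0 // => x; apply: forms_ge0.
apply: le_trans (avg_pow2_le _ _) _ => [h|]; first exact: forms_ge0.
apply: le_trans (_ : average (fun h => K ^+ size fs * cubeN (size fs) (mult_diff f ((d - d0) * h))) <= _).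
  apply: le_avg => h; have sz : size (forms_diff d0 h fs) = size fs by rewrite size_map.
  by rewrite -sz; apply: IH; [rewrite sz | exact: bounded1_diffs | exact: fibers_diffs].
rewrite avgZl exprSr -mulrA ler_wpM2l ?exprn_ge0 //.
by apply: (fb (fun h => cubeN (size fs) (mult_diff f h))) => h; apply: cubeN_ge0.
Qed.

End Averages.

(** * Gowers norms of digit windows modulo a power of 2 *)

Lemma cube_diff (R : realFieldType) (G : nat -> R) h t x :
  cube (fun y => G y * G (y + h)%N) (fun=> 0%N) t x =
  cube G (fun=> 0%N) t x * cube G (fun=> 0%N) t (x + h).
Proof.
elim: t x => [|u t IH] x /=; first by rewrite !addn0.
by rewrite !IH mulrACA addnAC.
Qed.

(** A function of z %/ 2 ^ T sees the T lowest digits only through the carries out of them. *)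
Lemma cube_div (R : realFieldType) (F : nat -> R) T c hs' hs0 x' x0 :
  size hs' = size hs0 ->
  cube (fun z => F (z %/ 2 ^ T)%N) c (shiftdig T hs' hs0) (2 ^ T * x' + x0) =
  cube F (carry T c hs0 x0) hs' x'.
Proof.
elim: hs0 hs' c x' x0 => [|h0 hs0 IH] [|h' hs'] c x' x0 //=.
  by move=> _; rewrite -addnA mulnC divnMDl ?expn_gt0.
case=> szh; rewrite IH // (_ : 2 ^ T * x' + x0 + (2 ^ T * h' + h0) =
  2 ^ T * (x' + h') + (x0 + h0))%N; last by lia.
by rewrite IH.
Qed.

Section Residues.
Variables (R : realFieldType) (m : nat).
Let M := m.+2.
Let Z : finComNzRingType := 'I_m.+2.

Lemma avg_ord (F : nat -> R) : average (fun x : Z => F (val x)) = M%:R^-1 * \sum_(0 <= x < M) F x.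
Proof. by rewrite /average card_ord big_mkord. Qed.

Lemma cubeU_ord k (G : nat -> R) : (forall x, G (x %% M)%N = G x) ->
  cubeU k (fun x : Z => G (val x)) =
  (M%:R ^+ k.+1)^-1 * \sum_(t <- words k M) \sum_(0 <= x < M) cube G (fun=> 0%N) t x.
Proof.
elim: k G => [|k IH] G GM.
  rewrite /= avg_ord expr1 big_seq1; congr (_ * _).
  by apply: eq_bigr => x _; rewrite /= addn0.
pose H h := (M%:R ^+ k.+1)^-1 *
  \sum_(t <- words k M) \sum_(0 <= x < M) cube G (fun=> 0%N) (h :: t) x.
have -> : (M%:R ^+ k.+2)^-1 * \sum_(t <- words k.+1 M) \sum_(0 <= x < M)
    cube G (fun=> 0%N) t x = M%:R^-1 * \sum_(0 <= h < M) H h.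
  by rewrite big_words exprS invfM -mulrA; congr (_ * _); rewrite big_distrr.
rewrite [LHS]/= -avg_ord; apply: eq_avg => h.
pose Gh y := G y * G (y + val h)%N.
rewrite (@eq_cubeU _ _ k _ (fun x : Z => Gh (val x))); last first.
  by move=> x; rewrite /mult_diff /Gh /= GM.
rewrite IH; last first.
  by move=> x; rewrite /Gh GM -(GM (x %% M + _)%N) modnDml GM.
by congr (_ * _); apply: eq_bigr => t _; apply: eq_bigr => x _; rewrite cube_diff.
Qed.

Lemma val_linear (a b : Z) d : val (a + d%:R * b) = ((val a + d * val b) %% M)%N.
Proof.
have -> : val (a + d%:R * b) = ((val a + val ((d%:R : Z) * b)%R) %% M)%N by [].
have -> : val ((d%:R : Z) * b) = ((val (d%:R : Z) * val b) %% M)%N by [].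
by rewrite Zp_nat /= modnMml modnDmr.
Qed.

Lemma le_sum_inj (A B : finType) (g : A -> B) (F : B -> R) :
  injective g -> (forall x, 0 <= F x) -> \sum_a F (g a) <= \sum_b F b.
Proof.
move=> gi F0; rewrite -(big_imset F (h := g) (A := predT)) /=; last by move=> x y _ _ /gi.
rewrite [leRHS](bigID (fun b => b \in [set g x | x in predT])) /= lerDl.
by apply: sumr_ge0.
Qed.

(* Given the residue y of d * h, the representative of h is determined by the
   quotient of d * h by M, which takes at most d values. *)
Lemma fiber_bounded_nat d : (0 < d)%N -> fiber_bounded (d%:R : R) (d%:R : Z).
Proof.
case: d => [//|d] _ F F0; rewrite /average mulrCA ler_wpM2l ?invr_ge0 ?ler0n //.
have qlt (h : Z) : ((d.+1 * val h) %/ M < d.+1)%N.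
  by rewrite ltn_divLR // ltn_pmul2l //; exact: ltn_ord.
pose g (h : Z) : Z * 'I_d.+1 := (d.+1%:R * h, Ordinal (qlt h)).
have gi : injective g.
  move=> h h' gE; apply: val_inj => /=.
  have := congr1 (fun p : Z * 'I_d.+1 => val p.2) gE; rewrite /= => e2.
  have := congr1 (fun p : Z * 'I_d.+1 => val p.1) gE; rewrite /g Zp_nat /= !modnMml => e1.
  have : (d.+1 * val h = d.+1 * val h')%N.
    by rewrite (divn_eq (d.+1 * val h) M) e2 e1 -divn_eq.
  by move/eqP; rewrite eqn_pmul2l // => /eqP.
apply: le_trans (le_sum_inj gi (F := fun p => F p.1) _) _ => [p|]; first exact: F0.
rewrite -(pair_bigA _ (fun x (_ : 'I_d.+1) => F x)) /= exchange_big /= sumr_const card_ord.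
by rewrite mulr_natl.
Qed.

End Residues.

Section Decay.
Variables (R : archiRealFieldType) (f : nat -> R).
Hypotheses (f0 : f 0%N = 1) (fD : forall n, f n.*2 = f n)
  (fS : forall n, f n.*2.+1 = - f n).

(** The mu digits below the window will be the binary places after the point in a fixed-point
    approximation to g. *)
Definition window_sign mu lam z := low_sign f lam (z %/ 2 ^ mu).

Lemma window_sign_mod mu lam z : window_sign mu lam (z %% 2 ^ (mu + lam)) = window_sign mu lam z.
Proof.
rewrite /window_sign /low_sign expnD; congr f.
rewrite [in RHS](divn_eq z (2 ^ mu * 2 ^ lam)) mulnCA [(2 ^ mu * (_ %/ _ * _))%N]mulnC.
by rewrite divnMDl ?expn_gt0 // modnMDl.
Qed.

Lemma window_sign_norm mu lam z : `|window_sign mu lam z| = 1.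
Proof. exact: low_sign_norm. Qed.

(** For each choice of the mu lowest digits the carries form an admissible offset, so the bound on
    [cube_sum] applies, uniformly in mu. *)
Lemma cubeU_decay (s a : nat) : (2 <= s)%N ->
  exists B : nat, forall rho mu lam m, (B * rho <= lam)%N -> m.+2 = (2 ^ (mu + lam))%N ->
    cubeU s (fun x : 'I_m.+2 => window_sign mu lam (val x)) <= (2 ^+ (a * rho))^-1.
Proof.
move=> s2; have [B HB] := cube_sum_power_saving a f0 fD fS s2.
exists B => rho mu lam m hlam mE; rewrite cubeU_ord; last first.
  by move=> x; rewrite mE window_sign_mod.
rewrite ler_pdivrMl ?exprn_gt0 //.
have -> : \sum_(t <- words s m.+2) \sum_(0 <= x < m.+2)
    cube (window_sign mu lam) (fun=> 0%N) t x =
  \sum_(t <- words s.+1 (2 ^ (mu + lam))) cubew (window_sign mu lam) (fun=> 0%N) t.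
  by rewrite big_words mE exchange_big.
rewrite big_words_split.
have -> : m.+2%:R ^+ s.+1 = (2 ^ mu)%:R ^+ s.+1 * (2 ^ lam)%:R ^+ s.+1 :> R.
  by rewrite mE expnD natrM exprMn.
apply: le_trans (ler_norm _) _; apply: le_trans (ler_norm_sum _ _ _) _.
pose b : R := (2 ^ lam)%:R ^+ s.+1 * (2 ^+ (a * rho))^-1.
apply: le_trans (_ : \sum_(t <- words s.+1 (2 ^ mu)) b <= _); last first.
  by rewrite big_const_seq count_predT size_words iter_addr_0 -mulrA -natrX mulr_natl.
rewrite big_seq [leRHS]big_seq; apply: ler_sum => t0 tw0.
have adm : admissible s (carryw mu (fun=> 0%N) t0) by apply: admissible_carry.
apply: le_trans (HB _ _ _ hlam adm); rewrite le_eqVlt; apply/orP; left; apply/eqP.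
congr `|_|; rewrite big_seq [RHS]big_seq; apply: eq_bigr => t' tw.
move: tw0 tw; rewrite !mem_words => /andP[/eqP sz0 _] /andP[/eqP sz' _].
case: t0 sz0 adm => [//|x0 hs0] /= [sz0] _; case: t' sz' => [//|x' hs'] /= [sz'].
by rewrite /cubew /= cube_div ?sz0 // sz'.
Qed.

Lemma forms_window mu lam m (D : seq nat) : m.+2 = (2 ^ (mu + lam))%N ->
  average (fun b : 'I_m.+2 => `|average (fun a : 'I_m.+2 => \prod_(d <- D) window_sign mu lam (val (a + d%:R * b)))|) =
  (m.+2%:R ^+ 2)^-1 * \sum_(0 <= b < m.+2) `|\sum_(0 <= a < m.+2) \prod_(d <- D) window_sign mu lam (a + d * b)|.
Proof.
move=> mE; pose H b := (m.+2%:R)^-1 * `|\sum_(0 <= a < m.+2) \prod_(d <- D) window_sign mu lam (a + d * b)|.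
rewrite expr2 invfM -mulrA mulr_sumr -[\sum_(0 <= _ < _) _]/(\sum_(0 <= b < m.+2) H b) -avg_ord.
apply: eq_avg => b.
have <- : average (fun a : 'I_m.+2 => \prod_(d <- D) window_sign mu lam (val a + d * val b)) =
  average (fun a : 'I_m.+2 => \prod_(d <- D) window_sign mu lam (val (a + d%:R * b))).
  apply: eq_avg => a; apply: eq_bigr => d _.
  by rewrite val_linear; move: (_ + _)%N => z; rewrite mE window_sign_mod.
rewrite (@avg_ord R m (fun a => \prod_(d <- D) window_sign mu lam (a + d * val b))).
by rewrite normrM ger0_norm ?invr_ge0.
Qed.

(** Eliminating k forms leads to [cubeN k], whose square is at most [cubeU k.+1]: hence the exponent
    2 ^ k.+1 and, from squaring the k fibre factors, the loss J ^ (2 * k). *)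
Lemma linear_forms_decay (k a : nat) : (1 <= k)%N ->
  exists B : nat, forall rho mu lam J (D : seq nat), (B * rho <= lam)%N -> (0 < mu + lam)%N ->
    size D = k.+1 -> uniq D -> all (fun d => d <= J)%N D ->
    (((2 ^ (mu + lam))%:R ^+ 2)^-1 * \sum_(0 <= b < 2 ^ (mu + lam))
      `|\sum_(0 <= a < 2 ^ (mu + lam)) \prod_(d <- D) window_sign mu lam (a + d * b)|) ^+ (2 ^ k.+1)
    <= J%:R ^+ (2 * k) * (2 ^+ (a * rho))^-1.
Proof.
move=> k1; have [B HB] := cubeU_decay a (s := k.+1) k1.
exists B => rho mu lam J D hlam mulam szD uD DJ.
have [m mE] : exists m, m.+2 = (2 ^ (mu + lam))%N.
  exists (2 ^ (mu + lam)).-2; have : (2 ^ 1 <= 2 ^ (mu + lam))%N by rewrite leq_exp2l.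
  by rewrite expn1; case: (2 ^ _)%N => [//|[//|]].
rewrite -mE -forms_window //.
(* The form that is kept has the largest multiplier d0, so every d0 - d is a positive integer at
   most J and [fiber_bounded_nat] applies. *)
pose D' := sort geq D.
have pD : perm_eq D D' by rewrite perm_sym perm_sort.
have szD' : size D' = k.+1 by rewrite -(perm_size pD).
have sD' : sorted geq D' by apply: sort_sorted => x y; exact: leq_total.
have uD' : uniq D' by rewrite -(perm_uniq pD).
have DJ' : all (fun d => d <= J)%N D' by rewrite -(perm_all _ pD).
pose phi (x : 'I_m.+2) := window_sign mu lam (val x).
under eq_avg => b do under eq_avg => a0 do rewrite (perm_big _ pD).
case: D' {pD} szD' sD' uD' DJ' => [//|d0 D'] /= [szD'] sD' /andP[d0D uD'] /andP[d0J DJ'].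
have d0max : all (geq d0) D' by rewrite (order_path_min _ sD') // => x y z /= xy yz; apply: leq_trans yz xy.
pose fs := [seq (phi, d%:R : 'I_m.+2) | d <- D'].
have -> : average (fun b : 'I_m.+2 => `|average (fun a0 : 'I_m.+2 =>
    \prod_(i <- (d0 :: D')) window_sign mu lam (val (a0 + i%:R * b)))|) = forms_average fs phi d0%:R.
  apply: eq_avg => b; congr `|_|; apply: eq_avg => a0.
  by rewrite big_cons /fs big_map.
have szfs : size fs = k by rewrite size_map.
have H : forms_average fs phi d0%:R ^+ (2 ^ size fs) <= J%:R ^+ size fs * cubeN (size fs) phi.
apply: forms_le_cubeN; first exact: ler0n.
- by rewrite /fs; elim: (D') => [//|d D0 IH] /=; split=> // x; rewrite window_sign_norm.
- rewrite /fs; elim: (D') d0D d0max => [//|d D0 IH] /=.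
  rewrite in_cons negb_or => /andP[dd0 d0D] /andP[d0d d0max]; split; last exact: IH.
  have dpos : (0 < d0 - d)%N by move: dd0 d0d; rewrite /geq /=; lia.
  have -> : (d0%:R - d%:R : 'I_m.+2) = (d0 - d)%:R by rewrite natrB.
  move=> F F0; apply: le_trans (fiber_bounded_nat dpos F0) _.
  rewrite ler_wpM2r ?avg_ge0 // ler_nat; lia.
rewrite szfs in H; rewrite expnS mulnC exprM.
apply: le_trans (_ : (J%:R ^+ k * cubeN k phi) ^+ 2 <= _).
  by apply: lerXn2r; rewrite ?nnegrE ?mulr_ge0 ?exprn_ge0 ?cubeN_ge0 ?forms_ge0.
rewrite exprMn -exprM mulnC ler_wpM2l ?exprn_ge0 //.
by apply: le_trans (cubeN_sqr _ _) _; apply: HB.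
Qed.

End Decay.

(** * Sequences with controlled second differences *)

Section Frac.
Variable R : archiRealFieldType.
Implicit Types (x y t s : R).

Definition frac_part x : R := x - (Num.truncn x)%:R.

Lemma frac_itv x : 0 <= x -> 0 <= frac_part x < 1.
Proof. by move=> /truncn_itv; rewrite /frac_part -natr1 => /andP[a b]; apply/andP; split; lra. Qed.

Lemma frac_lt (k : nat) x t : k%:R <= x -> x < k%:R + t -> frac_part x < t.
Proof.
move=> kx xk; have x0 : 0 <= x by apply: le_trans kx.
have : (k <= Num.truncn x)%N by rewrite truncn_ge_nat.
by rewrite -(ler_nat R) /frac_part; lra.
Qed.

(* Induction on T with the potential (k_T - k_0) (t / s + 1) + min (frac_part theta_T) (t + s) / s,
   where k_n is the integral part of theta_n. *)
Lemma count_frac (theta : nat -> R) A T s t : 0 < s -> 0 <= t ->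
  (forall n, (A <= n <= A + T)%N -> 0 <= theta n) ->
  (forall n, (A <= n < A + T)%N -> theta n + s <= theta n.+1) ->
  \sum_(A <= n < A + T) (frac_part (theta n) < t)%R%:R <=
    (theta (A + T)%N - theta A + 2) * (t / s + 1).
Proof.
move=> s0 t0 th0 ths.
pose k n : R := (Num.truncn (theta n))%:R.
have kfrac n : theta n = k n + frac_part (theta n) by rewrite /frac_part /k; lra.
have u0 : 0 <= t / s by rewrite divr_ge0 // ltW.
have us : (t / s) * s = t by rewrite divfK // gt_eqF.
have thA : 0 <= theta A by apply: th0; rewrite leqnn leq_addr.
have thT : 0 <= theta (A + T)%N by apply: th0; rewrite leqnn leq_addr.
have H T' : (T' <= T)%N -> \sum_(A <= n < A + T') (frac_part (theta n) < t)%R%:R <=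
    (k (A + T')%N - k A) * (t / s + 1) + Num.min (frac_part (theta (A + T')%N)) (t + s) / s.
  elim: T' => [_|T' IH T'T].
    rewrite addn0 big_geq // subrr mul0r add0r divr_ge0 ?(ltW s0) // le_min.
    have /andP[f0 _] := frac_itv thA.
    by rewrite f0; lra.
  rewrite addnS big_nat_recr ?leq_addr //=.
  have := IH (ltnW T'T); set S := \sum_(_ <= _ < _) _; set n := (A + T')%N.
  have st : theta n + s <= theta n.+1 by apply: ths; rewrite /n; lia.
  have n0 : 0 <= theta n by apply: th0; rewrite /n; lia.
  have n1 : 0 <= theta n.+1 by apply: th0; rewrite /n; lia.
  have /andP[f0 f1] := frac_itv n0; have /andP[g0 g1] := frac_itv n1.
  have km : (Num.truncn (theta n) <= Num.truncn (theta n.+1))%N by apply: le_truncn; lra.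
  move=> IHS; apply: le_trans (lerD IHS (lexx _)) _.
  rewrite -(ler_pM2r s0) !mulrDl divfK ?gt_eqF // divfK ?gt_eqF //.
  rewrite -!mulrA !mulrDl us mul1r.
  move: (kfrac n) (kfrac n.+1); rewrite /k; case: (ltngtP (Num.truncn (theta n)) (Num.truncn (theta n.+1))) km => // kk _.
    have : (Num.truncn (theta n)).+1%:R <= (Num.truncn (theta n.+1))%:R :> R by rewrite ler_nat.
    rewrite -natr1; set a := _%:R; set b := _%:R => ab _ _.
    have c0 : 0 <= Num.min (frac_part (theta n.+1)) (t + s) by rewrite le_min g0; lra.
    have cs : (Num.min (frac_part (theta n)) (t + s)) + (frac_part (theta n) < t)%R%:R * s <= t + s.
      by case: ltP => h; rewrite ?mul1r ?mul0r; [case: (leP (frac_part (theta n))) | rewrite addr0 ge_min lexx orbT]; lra.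
    have : 0 <= (b - a - 1) * (t + s) by rewrite mulr_ge0; lra.
    by move: (k A) => kA; move: c0 cs; move: (Num.min _ _) (Num.min _ _) => *; lra.
  rewrite -kk; set a := _%:R => e1 e2.
  have fg : frac_part (theta n) + s <= frac_part (theta n.+1) by lra.
  rewrite -addrA lerD2l.
  have : Num.min (frac_part (theta n)) (t + s) <= frac_part (theta n) by rewrite ge_min lexx.
  have : Num.min (frac_part (theta n)) (t + s) <= t + s by rewrite ge_min lexx orbT.
  move: (Num.min _ _) => M h1 h2; rewrite le_min; case: ltP => h; rewrite ?mul1r ?mul0r; apply/andP; split; lra.
apply: le_trans (H _ (leqnn T)) _.
have /andP[a0 a1] := frac_itv thT; have /andP[b0 b1] := frac_itv thA.
have mle : Num.min (frac_part (theta (A + T)%N)) (t + s) / s <= t / s + 1.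
  by rewrite ler_pdivrMr // mulrDl us mul1r ge_min lexx orbT.
have : 0 <= (theta (A + T)%N - theta A + 1 - (k (A + T)%N - k A)) * (t / s + 1).
  by apply: mulr_ge0; have := kfrac A; have := kfrac (A + T)%N; lra.
by move: mle; move: (Num.min _ _ / s) (t / s) => m u mle; lra.
Qed.
End Frac.

(** Abstract form of n ^ c on a dyadic range, with E in the role of N ^ (c - 2). The range extends
    to 4 * N to leave room for shifts of n. *)
Record growth (R : archiRealFieldType) (g : nat -> R) (N : nat) (c1 C1 E : R) : Prop := {
  growth_lower : 0 < c1;
  growth_upper : 1 <= C1;
  growth_scale : 0 < E;
  growth_ge0 : forall n, 0 <= g n;
  growth_diff : forall n, (N <= n <= 4 * N)%N -> 0 <= g n.+1 - g n <= C1 * (N%:R * E);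
  growth_diff2 : forall n, (N <= n <= 4 * N)%N ->
    c1 * E <= (g n.+2 - g n.+1) - (g n.+1 - g n) <= C1 * E }.

Section SecondDifferences.
Variables (R : archiRealFieldType) (g : nat -> R) (N : nat) (c1 C1 E : R).
Hypothesis G : growth g N c1 C1 E.
Let c1_gt0 := growth_lower G.
Let C1_ge1 := growth_upper G.
Let E_gt0 := growth_scale G.
Let g_ge0 := growth_ge0 G.
Let dg := growth_diff G.
Let ddg := growth_diff2 G.

Lemma le_g n m : (N <= n <= m)%N -> (m <= 4 * N)%N -> g n <= g m.
Proof.
move=> /andP[Nn nm] m4; rewrite -(subnKC nm) in m4 *.
elim: (m - n)%N m4 => [|r IH] m4; first by rewrite addn0.
have /andP[] := @dg (n + r)%N ltac:(lia).
by rewrite addnS subr_ge0 => h _; apply: le_trans (IH _) h; lia.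
Qed.

Lemma dg_diff n r : (N <= n)%N -> (n + r <= 4 * N)%N ->
  r%:R * (c1 * E) <= (g (n + r).+1 - g (n + r)%N) - (g n.+1 - g n) <= r%:R * (C1 * E).
Proof.
move=> Nn; elim: r => [|r IH] nr; first by rewrite addn0 !mul0r subrr lexx.
have /andP[h1 h2] := @ddg (n + r)%N ltac:(lia); have /andP[i1 i2] := IH ltac:(lia).
by rewrite addnS -natr1 !mulrDl !mul1r; apply/andP; split; lra.
Qed.

(** Second differences summed twice. Convexity makes the error one-sided, a fact on which the
    rounding argument for blocks relies. *)
Lemma g_linear n r : (N <= n)%N -> (n + r <= 4 * N)%N ->
  0 <= g (n + r)%N - g n - r%:R * (g n.+1 - g n) <= r%:R ^+ 2 * (C1 * E).
Proof.
move=> Nn; elim: r => [|r IH] nr.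
  by rewrite addn0 expr0n /= !mul0r subrr subr0 lexx.
have /andP[h1 h2] := @dg_diff n r ltac:(lia) ltac:(lia).
have /andP[i1 i2] := IH ltac:(lia).
have [c10 E0] := (ltW c1_gt0, ltW E_gt0); have C10 : 0 <= C1 by apply: le_trans C1_ge1.
have rE : 0 <= r%:R * (c1 * E) by rewrite !mulr_ge0.
have rE' : 0 <= r%:R * (C1 * E) by rewrite !mulr_ge0.
have CE : 0 <= C1 * E by rewrite mulr_ge0.
by rewrite addnS -natr1 sqrrD expr1n mulr1 !mulrDl !mul1r mulrnAl; apply/andP; split; lra.
Qed.

Local Notation psi r n := (g (n + r)%N - g n).

Lemma psi_range r A T : (N <= A)%N -> (A + T + r <= 4 * N)%N ->
  psi r (A + T) - psi r A <= T%:R * (r%:R * (C1 * E)).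
Proof.
move=> NA; elim: T => [|T IH] AT; first by rewrite addn0 subrr mul0r.
have := IH ltac:(lia); have /andP[_] := @dg_diff (A + T)%N r ltac:(lia) ltac:(lia).
rewrite addnS -natr1 mulrDl mul1r addSn.
by lra.
Qed.

(** Per step psi r grows by at least r * c1 * E and at most r * C1 * E, so [count_frac] applies to
    (psi r n + k) / Q. Adding k turns closeness to a multiple of Q from either side into a condition
    on one fractional part. *)
Lemma pair_count r A T (Q k : R) : (0 < r)%N -> (N <= A)%N -> (A + T + r <= 4 * N)%N ->
  0 < Q -> 0 <= k ->
  \sum_(A <= n < A + T) (frac_part ((psi r n + k) / Q) < 2 * k / Q)%R%:R <=
   (T%:R * (r%:R * (C1 * E)) / Q + 2) * (2 * k / (r%:R * (c1 * E)) + 1).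
Proof.
move=> r0 NA AT Q0 k0.
have rE : 0 < r%:R * (c1 * E) by rewrite !mulr_gt0 // ltr0n.
have Q0' : 0 < Q^-1 by rewrite invr_gt0.
have tQ : 0 <= 2 * k / Q by rewrite divr_ge0 ?mulr_ge0 // ltW.
apply: le_trans (count_frac (theta := fun n => (psi r n + k) / Q)
  (s := r%:R * (c1 * E) / Q) _ tQ _ _) _.
- by rewrite divr_gt0.
- move=> n hn; rewrite divr_ge0 ?(ltW Q0) // addr_ge0 // subr_ge0.
  by apply: le_g; lia.
- move=> n hn; rewrite -mulrDl ler_wpM2r ?(ltW Q0') //.
  have /andP[] := @dg_diff n r ltac:(lia) ltac:(lia).
  by rewrite addSn; lra.
have -> : 2 * k / Q / (r%:R * (c1 * E) / Q) = 2 * k / (r%:R * (c1 * E)).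
  by field; rewrite !gt_eqF // ltr0n.
apply: ler_wpM2r.
  by rewrite addr_ge0 // divr_ge0 ?mulr_ge0 // ltW.
by rewrite lerD2r -mulrBl ler_wpM2r ?(ltW Q0') //; have := psi_range NA AT; lra.
Qed.

(** This is m <= 1 + m * (m - 1) / 2 for the number m of indices at which x holds. *)
Lemma sum_le_pairs (x : nat -> bool) H :
  \sum_(0 <= h < H) (x h)%:R <= 1 + \sum_(0 <= h < H) \sum_(0 <= h' < h) (x h && x h')%:R :> R.
Proof.
elim: H => [|H IH]; first by rewrite !big_geq // addr0.
rewrite !big_nat_recr //=; case: (x H) => /=; last first.
  by rewrite [X in _ <= _ + (_ + X)]big1 // !addr0.
have : 0 <= \sum_(0 <= h < H) \sum_(0 <= h' < h) (x h && x h')%:R :> R.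
  by apply: sumr_ge0 => h _; apply: sumr_ge0.
by lra.
Qed.

(** Subtracting the integral parts leaves an error between -k and k. The divisions by 1 match
    [pair_count] at Q = 1. *)
Lemma frac_near_pair r n (k : R) : (N <= n)%N -> (n + r <= 4 * N)%N ->
  frac_part (g n) < k -> frac_part (g (n + r)%N) < k -> frac_part ((psi r n + k) / 1) < 2 * k / 1.
Proof.
move=> Nn nr h1 h2; rewrite !divr1.
have le1 : (Num.truncn (g n) <= Num.truncn (g (n + r)%N))%N.
  by apply: le_truncn; apply: le_g; lia.
apply: (@frac_lt _ (Num.truncn (g (n + r)%N) - Num.truncn (g n))); rewrite natrB //.
all: have := frac_itv (g_ge0 n); have := frac_itv (g_ge0 (n + r)%N).
all: by move: h1 h2; rewrite /frac_part => ? ? /andP[? ?] /andP[? ?]; lra.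
Qed.

Lemma sum_shift (F : nat -> R) h A T :
  \sum_(A <= n < A + T) F (n + h)%N = \sum_(A + h <= n < A + h + T) F n.
Proof. by rewrite [RHS]big_addn addnAC addnK; apply: eq_bigr. Qed.

(** The count is averaged over H shifts, and for each n the number of shifts with g (n + h) near an
    integer is bounded by 1 plus the number of such pairs. A pair h' < h forces g (n + h) - g (n +
    h') to be near an integer, which [pair_count] controls; H is free, to balance N / H against the
    pairs. *)
Lemma near_integer_count (H : nat) (k : R) : (0 < H)%N -> (H <= N)%N -> 0 <= k -> 1 <= N%:R * E ->
  \sum_(N <= n < 3 * N) (frac_part (g n) < k)%R%:R <=
   H%:R + 2 * N%:R / H%:R + H%:R * (8 * C1 / c1 * k * N%:R + 4 * C1 * H%:R * (N%:R * E)).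
Proof.
move=> H0 HN k0 NE; pose x n := frac_part (g n) < k; set X := \sum_(N <= n < 3 * N) _.
have HR : 0 < H%:R :> R by rewrite ltr0n.
have [c10 E0] := (ltW c1_gt0, ltW E_gt0); have C10 : 0 <= C1 by apply: le_trans C1_ge1.
pose B := 8 * C1 / c1 * k * N%:R + 4 * C1 * H%:R * (N%:R * E).
have B0 : 0 <= B by rewrite /B addr_ge0 // ?mulr_ge0 ?invr_ge0.
have N3 : (3 * N = N + 2 * N)%N by rewrite -[LHS]/(2.+1 * N)%N mulSn.
have up : \sum_(N <= n < 3 * N) \sum_(0 <= h < H) (x (n + h)%N)%:R <= 2 * N%:R + H%:R * (H%:R * B).
  apply: le_trans (_ : \sum_(N <= n < 3 * N) (1 + \sum_(0 <= h < H) \sum_(0 <= h' < h)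
     (x (n + h)%N && x (n + h')%N)%:R) <= _).
    by apply: ler_sum => n _; apply: (sum_le_pairs (fun h => x (n + h)%N)).
  rewrite big_split /=; apply: lerD.
    by rewrite sumr_const_nat N3 addKn natrM.
  rewrite exchange_big /=.
  have -> : H%:R * (H%:R * B) = \sum_(0 <= h < H) (H%:R * B).
    by rewrite sumr_const_nat subn0 mulr_natl.
  rewrite big_nat [leRHS]big_nat; apply: ler_sum => h /andP[_ hH].
  rewrite exchange_big /=.
  apply: le_trans (_ : \sum_(0 <= h' < h) B <= _); last first.
    by rewrite sumr_const_nat subn0 -[B *+ h]mulr_natl ler_wpM2r // ler_nat ltnW.
  rewrite big_nat [leRHS]big_nat; apply: ler_sum => h' /andP[_ h'h].
  have r0 : (0 < h - h')%N by rewrite subn_gt0.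
  have n1 : (N <= N + h')%N by exact: leq_addr.
  have n2 : (N + h' + 2 * N + (h - h') <= 4 * N)%N by clear -hH HN h'h; lia.
  have := @pair_count (h - h') (N + h') (2 * N) 1 k r0 n1 n2 ltr01 k0.
  set S := \sum_(_ <= _ < _) _ => pc; apply: (@le_trans _ _ S).
    rewrite /S N3 -sum_shift; apply: ler_sum_nat => n hn; rewrite ler_nat.
    case: (boolP (x (n + h)%N && x (n + h')%N)) => // /andP[x1 x2].
    have e : (n + h' + (h - h') = n + h)%N by rewrite -addnA subnKC // ltnW.
    have a1 : (N <= n + h')%N by clear -hn; lia.
    have a2 : (n + h' + (h - h') <= 4 * N)%N by rewrite e; clear -hn hH HN; lia.
    have := @frac_near_pair (h - h') (n + h') k a1 a2 x2.
    by rewrite e => -> .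
  apply: le_trans pc _; rewrite divr1.
  have rH : (h - h')%:R <= H%:R :> R by rewrite ler_nat (leq_trans (leq_subr _ _)) // ltnW.
  have r1 : 1 <= (h - h')%:R :> R by rewrite ler1n.
  move: ((h - h')%:R) r1 rH => r r1 rH; have r0' : 0 < r by apply: lt_le_trans r1.
  have z0 : 0 <= 2 * k / (r * (c1 * E)).
    by rewrite divr_ge0 ?mulr_ge0 // ltW.
  have w1 : 1 <= C1 * (r * (N%:R * E)).
    by apply: mulr_ege1 => //; apply: mulr_ege1.
  (* As C1 * r * N * E >= 1, the boundary term 2 is absorbed by doubling the main term 2 * C1 * r *
     N * E. *)
  apply: le_trans (_ : 4 * (C1 * (r * (N%:R * E))) * (2 * k / (r * (c1 * E)) + 1) <= _).
    apply: ler_wpM2r; first by lra.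
    by rewrite natrM; move: w1; lra.
  rewrite mulrDr mulr1 /B; apply: lerD.
    rewrite le_eqVlt; apply/orP; left; apply/eqP; field.
    by rewrite !gt_eqF.
  have NE0 : 0 <= C1 * (N%:R * E) by rewrite !mulr_ge0.
  by have := ler_wpM2r NE0 rH; lra.
have low : H%:R * (X - H%:R) <= \sum_(N <= n < 3 * N) \sum_(0 <= h < H) (x (n + h)%N)%:R.
  have -> : H%:R * (X - H%:R) = \sum_(0 <= h < H) (X - H%:R).
    by rewrite sumr_const_nat subn0 mulr_natl.
  rewrite exchange_big /=.
  apply: ler_sum_nat => h /andP[_ hH].
  rewrite N3 (@sum_shift (fun n => (x n)%:R)) lerBlDr /X (@big_cat_nat _ _ _ (N + h)) /=; try by clear -hH HN; lia.
  rewrite addrC; apply: lerD.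
    apply: le_trans (_ : \sum_(N + h <= n < 3 * N) (x n)%:R <= _) => //.
    rewrite (_ : N + h + 2 * N = 3 * N + h)%N; last by clear; lia.
    rewrite [leRHS](@big_cat_nat _ _ _ (3 * N)) /=; try by clear -hH HN; lia.
    by rewrite lerDl; apply: sumr_ge0.
  apply: le_trans (_ : \sum_(N <= n < N + h) 1 <= _).
    by apply: ler_sum => n _; rewrite -[1]/(1%:R) ler_nat; case: (_ < _).
  by rewrite sumr_const_nat ler_nat; clear -hH; lia.
have := le_trans low up => main; rewrite -/B.
rewrite -(ler_pM2l HR) !mulrDr.
have -> : H%:R * (2 * N%:R / H%:R) = 2 * N%:R :> R by field; rewrite gt_eqF.
by move: main; rewrite /B mulrBr; lra.
Qed.
End SecondDifferences.

(** * Equidistribution of block states in mean square *)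

Section CauchySchwarz.
Variables (R : realFieldType) (T : eqType) (s : seq T) (p : nat -> T) (A B : nat).
Hypotheses (us : uniq s) (ps : forall n, (A <= n < B)%N -> p n \in s).

Lemma sum_delta_seq (W : T -> R) x : x \in s -> \sum_(y <- s) (x == y)%:R * W y = W x.
Proof.
move=> xs; rewrite (bigD1_seq x) //= eqxx mul1r big1 ?addr0 // => y.
by rewrite eq_sym => /negPf->; rewrite mul0r.
Qed.

(** Cauchy-Schwarz in the form 2 * u * v <= t * u ^ 2 + v ^ 2 / t, with u the number of n in a cell
    and v its weight. The squares of the cell counts add up to the number of coincidences. *)
Lemma sum_le_energy (W : T -> R) t : 0 < t ->
  2 * \sum_(A <= n < B) W (p n) <=
  t * \sum_(A <= n < B) \sum_(A <= n' < B) (p n == p n')%:R + t^-1 * \sum_(y <- s) W y ^+ 2.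
Proof.
move=> t0; pose cnt y : R := \sum_(A <= n < B) (p n == y)%:R.
have -> : \sum_(A <= n < B) W (p n) = \sum_(y <- s) cnt y * W y.
  under [RHS]eq_bigr => y _ do rewrite mulr_suml.
  rewrite exchange_big /=; apply: eq_big_nat => n hn.
  by rewrite sum_delta_seq // ps.
have -> : \sum_(A <= n < B) \sum_(A <= n' < B) (p n == p n')%:R = \sum_(y <- s) cnt y ^+ 2 :> R.
  under [RHS]eq_bigr => y _ do rewrite expr2 {1}/cnt mulr_suml.
  rewrite [RHS]exchange_big /=; apply: eq_big_nat => n hn.
  rewrite (@sum_delta_seq cnt) ?ps //; apply: eq_bigr => n' _.
  by rewrite eq_sym.
rewrite !mulr_sumr -big_split /=; apply: ler_sum => y _.
have : 0 <= t^-1 * (t * cnt y - W y) ^+ 2 by rewrite mulr_ge0 ?sqr_ge0 // invr_ge0 ltW.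
have -> : t^-1 * (t * cnt y - W y) ^+ 2 =
  t * cnt y ^+ 2 + t^-1 * W y ^+ 2 - 2 * (cnt y * W y).
  by field; rewrite gt_eqF.
by rewrite subr_ge0.
Qed.
End CauchySchwarz.

(** The diagonal gives at most T; by symmetry the other pairs are counted twice, sorted by their
    difference r. *)
Lemma sum_sym_le (R : realFieldType) (e : nat -> nat -> bool) A T :
  (forall n m, e n m = e m n) ->
  \sum_(A <= n < A + T) \sum_(A <= n' < A + T) (e n n')%:R <=
  T%:R + 2 * \sum_(1 <= r < T) \sum_(A <= n < A + (T - r)) (e n (n + r)%N)%:R :> R.
Proof.
move=> es; elim: T => [|T IH]; first by rewrite addn0 !big_geq // mulr0 addr0.
have stepr : \sum_(1 <= r < T.+1) \sum_(A <= n < A + (T.+1 - r)) (e n (n + r)%N)%:R =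
  \sum_(1 <= r < T) \sum_(A <= n < A + (T - r)) (e n (n + r)%N)%:R +
  \sum_(A <= n < A + T) (e n (A + T)%N)%:R :> R.
  case: T {IH} => [|T]; first by rewrite !big_geq ?addr0 // addn0.
  rewrite big_nat_recr //= subSnn addn1 big_nat1.
  have -> : \sum_(1 <= r < T.+1) \sum_(A <= n < A + (T.+2 - r)) (e n (n + r)%N)%:R =
    \sum_(1 <= r < T.+1) (\sum_(A <= n < A + (T.+1 - r)) (e n (n + r)%N)%:R +
      (e (A + (T.+1 - r))%N (A + T.+1)%N)%:R) :> R.
    apply: eq_big_nat => r /andP[r1 rT]; rewrite subSn; last by lia.
    rewrite addnS big_nat_recr ?leq_addr //=; congr (_ + (e _ _)%:R).
    by lia.
  rewrite big_split /= -addrA; congr (_ + _).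
  rewrite [RHS]big_ltn; last by lia.
  rewrite addrC; congr (_ + _).
  rewrite big_nat_rev /= [RHS](_ : _ = \sum_(A + 1 <= n < A + T.+1) (e n (A + T.+1)%N)%:R); last by rewrite addn1.
  rewrite -[in RHS](addnC 1%N) [RHS]big_addn.
  rewrite (_ : A + T.+1 - A = T.+1)%N; last by lia.
  apply: eq_big_nat => r /andP[r1 rT]; congr (e _ _)%:R; lia.
rewrite stepr addnS big_nat_recr ?leq_addr //=.
have -> : \sum_(A <= n' < (A + T).+1) (e (A + T)%N n')%:R = \sum_(A <= n < A + T) (e n (A + T)%N)%:R + (e (A + T)%N (A + T)%N)%:R :> R.
  by rewrite big_nat_recr ?leq_addr //=; congr (_ + _); apply: eq_bigr => n _; rewrite es.
have -> : \sum_(A <= n < A + T) \sum_(A <= n' < (A + T).+1) (e n n')%:R =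
  \sum_(A <= n < A + T) \sum_(A <= n' < A + T) (e n n')%:R + \sum_(A <= n < A + T) (e n (A + T)%N)%:R :> R.
  by rewrite -big_split /=; apply: eq_bigr => n _; rewrite big_nat_recr ?leq_addr.
have : (e (A + T)%N (A + T)%N)%:R <= 1 :> R by case: (e _ _).
rewrite -[T.+1%:R]natr1 mulrDr.
by move: IH; move: (\sum_(_ <= _ < _) _) => S1; lra.
Qed.

Lemma sum_lt_le (R : realFieldType) (P : R) T : 0 <= P ->
  \sum_(1 <= r < T) (r%:R < P)%R%:R <= P.
Proof.
move=> P0; suff H : \sum_(1 <= r < T) (r%:R < P)%R%:R <= P /\
   \sum_(1 <= r < T) (r%:R < P)%R%:R <= T.-1%:R :> R by case: H.
elim: T => [|[|T] IH]; try by rewrite big_geq.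
rewrite big_nat_recr //=; case: IH; rewrite /= -[T.+1%:R]natr1.
by case: ltP => /= h h1 h2; rewrite ?addr0; lra.
Qed.

Section Energy.
Variables (R : archiRealFieldType) (g : nat -> R) (N : nat) (c1 C1 E : R).
Hypothesis G : growth g N c1 C1 E.
Let c1_gt0 := growth_lower G.
Let C1_ge1 := growth_upper G.
Let E_gt0 := growth_scale G.
Let g_ge0 := growth_ge0 G.
Let dg := growth_diff G.
Let ddg := growth_diff2 G.
Variables K Q : nat.
Hypotheses (K_gt0 : (0 < K)%N) (Q_gt0 : (0 < Q)%N).

(* The cell of (g n mod Q, g n.+1 - g n) in the grid of mesh 1 / K. *)
Definition position n := Num.truncn (g n * K%:R).
Definition slope n := Num.truncn ((g n.+1 - g n) * K%:R).
Definition block_state n := (position n %% (K * Q), slope n)%N.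

(** Equal positions modulo K * Q put K * (g (n + r) - g n) within 1 of a multiple of K * Q. *)
Lemma state_near r n : (N <= n)%N -> (n + r <= 3 * N)%N -> block_state n = block_state (n + r) ->
  frac_part ((g (n + r)%N - g n + K%:R^-1) / Q%:R) < 2 * K%:R^-1 / Q%:R.
Proof.
move=> Nn nr [eqa _].
have KR : 0 < K%:R :> R by rewrite ltr0n.
have QR : 0 < Q%:R :> R by rewrite ltr0n.
have gle : g n <= g (n + r)%N by apply: (le_g G); clear -Nn nr; lia.
have ale : (position n <= position (n + r))%N.
  by apply: le_truncn; rewrite ler_wpM2r // ltW.
have /dvdnP[k kE] : (K * Q %| position (n + r) - position n)%N by rewrite -eqn_mod_dvd // eqa.
have /andP[a1 a2] := truncn_itv (mulr_ge0 (g_ge0 n) (ltW KR)).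
have /andP[b1 b2] := truncn_itv (mulr_ge0 (g_ge0 (n + r)%N) (ltW KR)).
rewrite -/(position _) -natr1 in a1 a2; rewrite -/(position _) -natr1 in b1 b2.
have kR : (position (n + r))%:R - (position n)%:R = k%:R * (K%:R * Q%:R) :> R.
  by rewrite -natrB // kE !natrM.
have KK : K%:R^-1 * K%:R = 1 :> R by rewrite mulVf ?gt_eqF.
apply: (@frac_lt _ k).
  rewrite ler_pdivlMr // -(ler_pM2r KR) mulrDl mulrBl KK.
  by move: kR; rewrite (mulrC K%:R) mulrA; lra.
rewrite ltr_pdivrMr // -(ltr_pM2r KR) !mulrDl divfK ?gt_eqF // !mul1r !KK.
by move: kR; rewrite (mulrC K%:R) mulrA; lra.
Qed.

(** Over r steps the first difference of g grows by at least r * c1 * E, and equal slopes require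
    this to be below the mesh 1 / K. *)
Lemma state_slope r n : (N <= n)%N -> (n + r <= 3 * N)%N -> block_state n = block_state (n + r) ->
  r%:R < (K%:R * (c1 * E))^-1.
Proof.
move=> Nn nr [_ eqb].
have KR : 0 < K%:R :> R by rewrite ltr0n.
have Nr : (n + r <= 4 * N)%N by clear -nr; lia.
have /andP[d1 _] := dg_diff G Nn Nr.
have /andP[e1 _] := @dg n ltac:(clear -Nn nr; lia).
have /andP[e2 _] := @dg (n + r)%N ltac:(clear -Nn nr; lia).
have /andP[a1 a2] := truncn_itv (mulr_ge0 e1 (ltW KR)).
have /andP[b1 b2] := truncn_itv (mulr_ge0 e2 (ltW KR)).
rewrite -/(slope _) -natr1 in a1 a2; rewrite -/(slope _) -natr1 -eqb in b1 b2.
have cE : 0 < c1 * E by rewrite mulr_gt0.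
rewrite -[X in _ < X]mul1r ltr_pdivlMr ?mulr_gt0 // mulrCA mulrC.
have := ler_wpM2r (ltW KR) d1; rewrite [(_ - _ - _) * _]mulrBl.
by lra.
Qed.

Hypotheses (NE_ge1 : 1 <= N%:R * E) (QEK : Q%:R * E * K%:R ^+ 2 <= 1)
  (Q_le : Q%:R <= 2 * (N%:R * E) * K%:R).

(** [pair_count] gives a main term independent of r and a boundary term 6 / (K * c1 * E * r). For r
    >= Q / (N * E) the latter is absorbed into the former, whence 9 = 3 + 6; smaller r are kept
    apart in the second summand. *)
Lemma state_shift_count r : (0 < r < N)%N ->
  \sum_(N <= n < N + (N - r)) (block_state n == block_state (n + r)%N)%:R <=
  (r%:R < (K%:R * (c1 * E))^-1)%R%:R * (9 * C1 * N%:R / (c1 * K%:R * Q%:R)) +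
  (r%:R < Q%:R / (N%:R * E))%R%:R * (6 / (K%:R * (c1 * E))).
Proof.
move=> /andP[r0 rN].
have N0 : (0 < N)%N by apply: leq_trans rN.
have [KR QR rR NR] : [/\ 0 < K%:R :> R, 0 < Q%:R :> R, 0 < r%:R :> R & 0 < N%:R :> R].
  by split; rewrite ltr0n.
have C10 : 0 < C1 by apply: lt_le_trans C1_ge1.
have [C1' E' c1'] := And3 (ltW C10) (ltW E_gt0) (ltW c1_gt0).
have X0 : 0 <= 9 * C1 * N%:R / (c1 * K%:R * Q%:R).
  by rewrite divr_ge0 ?mulr_ge0.
have Y0 : 0 <= 6 / (K%:R * (c1 * E)) by rewrite divr_ge0 ?mulr_ge0.
case: (ltP r%:R (K%:R * (c1 * E))^-1) => [rP|rP]; last first.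
  rewrite big_nat big1 => [|n hn].
    by rewrite mul0r add0r mulr_ge0.
  case: eqP => // st; have := @state_slope r n ltac:(clear -hn; lia) ltac:(clear -hn; lia) st.
  by rewrite ltNge rP.
have k0 : 0 <= K%:R^-1 :> R by rewrite invr_ge0 ltW.
have := @pair_count _ _ _ _ _ _ G r N (N - r) Q%:R K%:R^-1
  r0 (leqnn N) ltac:(clear -rN; lia) QR k0.
set S := \sum_(_ <= _ < _) _ => pc; apply: (@le_trans _ _ S).
  apply: ler_sum_nat => n hn; rewrite ler_nat; case: eqP => // st.
  by rewrite state_near //; clear -hn; lia.
apply: le_trans pc _; rewrite mul1r.
set z := (K%:R * (r%:R * (c1 * E)))^-1.
have z0 : 0 < z by rewrite invr_gt0 !mulr_gt0.
have z1 : 1 <= z.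
  have -> : z = (K%:R * (c1 * E))^-1 / r%:R.
    by rewrite /z -invfM; congr (_^-1); ring.
  by rewrite ler_pdivlMr // mul1r ltW.
have -> : 2 * K%:R^-1 / (r%:R * (c1 * E)) = 2 * z by rewrite /z (invfM K%:R) -mulrA.
apply: le_trans (_ : (N%:R * (r%:R * (C1 * E)) / Q%:R + 2) * (3 * z) <= _).
  have CE : 0 < r%:R * (C1 * E) by rewrite !mulr_gt0.
  have a0 : 0 <= (N - r)%:R * (r%:R * (C1 * E)) / Q%:R by rewrite divr_ge0 ?mulr_ge0.
  apply: ler_pM; [by lra | by lra | | by lra].
  by rewrite lerD2r ler_pM2r ?invr_gt0 // ler_pM2r // ler_nat leq_subr.
rewrite [leLHS]mulrDl.
have -> : N%:R * (r%:R * (C1 * E)) / Q%:R * (3 * z) = 3 * C1 * N%:R / (c1 * K%:R * Q%:R).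
  by rewrite /z; field; rewrite !gt_eqF.
have zE : 2 * (3 * z) = 6 / (K%:R * (c1 * E)) * r%:R^-1.
  by rewrite /z; field; rewrite !gt_eqF.
rewrite zE; pose v := C1 * N%:R / (c1 * K%:R * Q%:R).
have v0 : 0 <= v by rewrite divr_ge0 ?mulr_ge0.
have vE a : a * C1 * N%:R / (c1 * K%:R * Q%:R) = a * v by rewrite /v !mulrA.
rewrite !vE; case: ltP => hr.
  have r1 : r%:R^-1 <= 1 :> R by rewrite invf_le1 // ler1n.
  by have := ler_wpM2l Y0 r1; rewrite mulr1 mul1r; lra.
have r1 : r%:R^-1 <= N%:R * E / Q%:R.
  by rewrite -[leRHS]invrK lef_pV2 ?posrE ?invr_gt0 ?divr_gt0 ?mulr_gt0 // invf_div.
have := ler_wpM2l Y0 r1.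
have -> : 6 / (K%:R * (c1 * E)) * (N%:R * E / Q%:R) = 6 * (N%:R / (c1 * K%:R * Q%:R)).
  by field; rewrite !gt_eqF.
have : N%:R / (c1 * K%:R * Q%:R) <= v.
  by rewrite /v -[leRHS]mulrA ler_peMl // divr_ge0 ?mulr_ge0 ?ltW.
by rewrite mul0r addr0; lra.
Qed.

(** Up to constants there are K * Q positions and K * N * E slopes, so the right side is N ^ 2
    divided by the number of cells, the order expected of random states. [QEK] says that the cells
    number about N at most, and so bounds the diagonal. *)
Lemma energy_le :
  \sum_(N <= n < N + N) \sum_(N <= n' < N + N) (block_state n == block_state n')%:R <=
  (1 + 18 * C1 / c1 ^+ 2 + 24 / c1) * (N%:R / (K%:R ^+ 2 * Q%:R * E)).
Proof.
have N0 : (0 < N)%N.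
  by case: (posnP N) NE_ge1 => // ->; rewrite mul0r ler10.
have [KR QR NR] : [/\ 0 < K%:R :> R, 0 < Q%:R :> R & 0 < N%:R :> R] by split; rewrite ltr0n.
have C10 : 0 < C1 by apply: lt_le_trans C1_ge1.
have [C1' E' c1'] := And3 (ltW C10) (ltW E_gt0) (ltW c1_gt0).
set D := N%:R / _.
have ND : N%:R <= D.
  by rewrite ler_pdivlMr ?mulr_gt0 ?exprn_gt0 // ler_piMr ?(ltW NR) //; move: QEK; lra.
apply: le_trans (@sum_sym_le R (fun n m => block_state n == block_state m) N N _) _ => [n m|].
  exact: eq_sym.
pose X := 9 * C1 * N%:R / (c1 * K%:R * Q%:R); pose Y := 6 / (K%:R * (c1 * E)).
have X0 : 0 <= X by rewrite divr_ge0 ?mulr_ge0.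
have Y0 : 0 <= Y by rewrite divr_ge0 ?mulr_ge0.
have H : \sum_(1 <= r < N) \sum_(N <= n < N + (N - r)) (block_state n == block_state (n + r)%N)%:R
   <= (K%:R * (c1 * E))^-1 * X + Q%:R / (N%:R * E) * Y.
  apply: le_trans (_ : \sum_(1 <= r < N) ((r%:R < (K%:R * (c1 * E))^-1)%R%:R * X +
     (r%:R < Q%:R / (N%:R * E))%R%:R * Y) <= _).
    by apply: ler_sum_nat => r hr; apply: state_shift_count.
  rewrite big_split /= -!mulr_suml; apply: lerD; apply: ler_wpM2r => //; apply: sum_lt_le.
    by rewrite invr_ge0 ?mulr_ge0.
  by rewrite divr_ge0 ?mulr_ge0.
have e1 : (K%:R * (c1 * E))^-1 * X = 9 * C1 / c1 ^+ 2 * D.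
  by rewrite /X /D; field; rewrite !gt_eqF.
have e2 : Q%:R / (N%:R * E) * Y <= 12 / c1 * D.
  apply: le_trans (_ : 12 / c1 * N%:R <= _); last by rewrite ler_wpM2l // divr_ge0 // ltW.
  have -> : Q%:R / (N%:R * E) * Y = Q%:R * (6 / (N%:R * E * (K%:R * (c1 * E)))).
    by rewrite /Y; field; rewrite !gt_eqF.
  have z0 : 0 <= 6 / (N%:R * E * (K%:R * (c1 * E))) by rewrite divr_ge0 ?mulr_ge0.
  apply: le_trans (ler_wpM2r z0 Q_le) _.
  have -> : 2 * (N%:R * E) * K%:R * (6 / (N%:R * E * (K%:R * (c1 * E)))) = 12 / c1 / E.
    by field; rewrite !gt_eqF.
  by rewrite ler_pM2l ?divr_gt0 // -[_^-1]mul1r ler_pdivrMr.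
apply: le_trans (lerD ND (ler_wpM2l _ H)) _ => //; rewrite e1.
have -> : 18 * C1 / c1 ^+ 2 = 2 * (9 * C1 / c1 ^+ 2) by field; rewrite gt_eqF.
have -> : 24 / c1 = 2 * (12 / c1) by field; rewrite gt_eqF.
by move: e2; move: (9 * C1 / _) (12 / c1) (_ * Y) => u v w; lra.
Qed.

End Energy.

(** * Block sums *)

Section Blocks.
Variables (R : archiRealFieldType) (f : nat -> R).
Hypotheses (f0 : f 0%N = 1) (fD : forall n, f n.*2 = f n)
  (fS : forall n, f n.*2.+1 = - f n).
Variables (g : nat -> R) (N : nat) (c1 C1 E : R).
Hypothesis G : growth g N c1 C1 E.
Variables (mu lam J : nat).
Let K := (2 ^ mu)%N.
Let Q := (2 ^ lam)%N.
Hypothesis JN : (J <= N)%N.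

(** The first term bounds the rounding errors of the position and of up to J slopes, the second the
    error of linearisation. *)
Definition proximity : R := (1 + J)%:R / K%:R + J%:R ^+ 2 * (C1 * E).
Definition near_integer n := frac_part (g n) < proximity.
Definition high_part n := Num.truncn (g n / Q%:R).

Let KR : 0 < K%:R :> R. Proof. by rewrite ltr0n expn_gt0. Qed.
Let QR : 0 < Q%:R :> R. Proof. by rewrite ltr0n expn_gt0. Qed.

(** Both roundings go down and g is convex, so the linear expression lies below K * g (n + j), by at
    most K * [proximity]. The two floors can differ only when g (n + j) is just above an integer. *)
Lemma truncn_linear n j : (N <= n < 2 * N)%N -> (j <= J)%N -> ~~ near_integer (n + j) ->
  ((position g K n + j * slope g K n) %/ K = Num.truncn (g (n + j)%N))%N.
Proof.
move=> hn jJ; rewrite -leNgt => far.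
have n4 : (N <= n <= 4 * N)%N by clear -hn; lia.
have nj4 : (n + j <= 4 * N)%N by clear -hn jJ JN; lia.
have /andP[Nn _] := hn.
have /andP[l1 l2] := g_linear G Nn nj4.
have /andP[d1 _] := growth_diff G n4.
have /andP[a1 a2] := truncn_itv (mulr_ge0 (growth_ge0 G n) (ltW KR)).
have /andP[b1 b2] := truncn_itv (mulr_ge0 d1 (ltW KR)).
rewrite -/(position _ _ _) -natr1 in a1 a2; rewrite -/(slope _ _ _) -natr1 in b1 b2.
have /andP[t1 t2] := truncn_itv (growth_ge0 G (n + j)%N).
move: far; rewrite /frac_part; set t := Num.truncn (g (n + j)%N) in t1 t2 *.
rewrite -natr1 in t2 => far.
have CE : 0 <= C1 * E by rewrite mulr_ge0 ?(ltW (growth_scale G)) // (le_trans _ (growth_upper G)).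
have jR : j%:R <= J%:R :> R by rewrite ler_nat.
have jj : j%:R ^+ 2 * (C1 * E) <= J%:R ^+ 2 * (C1 * E).
  by rewrite ler_wpM2r // lerXn2r // nnegrE ler0n.
pose p : R := (position g K n)%:R; pose s : R := (slope g K n)%:R.
have sj1 : j%:R * s <= j%:R * ((g n.+1 - g n) * K%:R) by rewrite ler_wpM2l.
have sj2 : j%:R * ((g n.+1 - g n) * K%:R) <= j%:R * (s + 1) by rewrite ler_wpM2l // ltW.
have up : p + j%:R * s <= g (n + j)%N * K%:R.
  have := ler_wpM2r (ltW KR) l1; rewrite mul0r !mulrBl; rewrite /p; lra.
have lo : t%:R * K%:R <= p + j%:R * s.
  have := ler_wpM2r (ltW KR) (le_trans far (_ : _ <= g (n + j)%N - t%:R)).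
  move=> /(_ (lexx _)); rewrite /proximity mulrDl divfK ?gt_eqF // natrD mulrBl.
  have := ler_wpM2r (ltW KR) (le_trans l2 jj); rewrite !mulrBl; rewrite /p.
  lra.
have upt : p + j%:R * s < (t%:R + 1) * K%:R.
  by apply: le_lt_trans up _; rewrite ltr_pM2r.
apply/eqP; rewrite eqn_leq leq_divRL ?expn_gt0 // -ltnS ltn_divLR ?expn_gt0 //.
rewrite -(ltr_nat R) -(ler_nat R) !natrM !natrD -[t.+1%:R]natr1 natrM.
by rewrite -/p -/s upt lo.
Qed.

Lemma lap_le n m : (N <= n <= m)%N -> (m <= 4 * N)%N -> (high_part n <= high_part m)%N.
Proof.
move=> nm m4; apply: le_truncn; rewrite ler_pM2r ?invr_gt0 //; exact: (le_g G).
Qed.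

Lemma lapE n : high_part n = (Num.truncn (g n) %/ Q)%N.
Proof.
have gQ : 0 <= g n / Q%:R by rewrite divr_ge0 ?(growth_ge0 G) ?ltW.
have /andP[a1 a2] := truncn_itv gQ; rewrite -/(high_part n) in a1 a2.
rewrite ler_pdivlMr // in a1; rewrite ltr_pdivrMr // in a2.
apply/esym/eqP; rewrite eqn_leq leq_divRL ?expn_gt0 // -ltnS ltn_divLR ?expn_gt0 //.
rewrite truncn_ge_nat ?truncn_lt_nat ?(growth_ge0 G) // !natrM.
by rewrite a1 a2.
Qed.

(** The digits of weight at least 2 ^ lam agree at n and n + J, hence by monotonicity at n + j; the
    lower ones are read off from the linear approximation. *)
Lemma good_point n j : (N <= n < 2 * N)%N -> (j <= J)%N -> ~~ near_integer (n + j) ->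
  high_part (n + J) = high_part n ->
  f (Num.truncn (g (n + j)%N)) =
  f (high_part n) * window_sign f mu lam (position g K n + j * slope g K n).
Proof.
move=> hn jJ far lapn.
have e : high_part (n + j) = high_part n.
  apply/eqP; rewrite eqn_leq -{1}lapn !lap_le //; clear -hn jJ JN; lia.
rewrite /window_sign /low_sign -/K (truncn_linear hn jJ far) -/Q -e lapE.
rewrite {1}(divn_eq (Num.truncn (g (n + j)%N)) Q) mulnC (sign_split f0 fD fS) //.
by rewrite ltn_mod expn_gt0.
Qed.

Variable I : seq nat.
Definition correlation n := \prod_(i <- I) f (Num.truncn (g (n + i)%N)).
Definition block_sum T (p : nat * nat) :=
  \sum_(0 <= m < T) \prod_(i <- I) window_sign f mu lam (p.1 + (m + i) * p.2).

Lemma prod_sign_norm (r : seq nat) (h : nat -> nat) : `|\prod_(i <- r) f (h i)| = 1.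
Proof.
rewrite normr_prod big1 // => i _; exact: (sign_norm f0 fD fS).
Qed.

(** If the high part changes, the trivial bound T is paid for by the last term. Otherwise each m
    with a shift near an integer costs at most 2, and the other terms are a constant sign times
    those of [block_sum]. *)
Lemma block_le T n : (N <= n < 2 * N)%N -> (forall m i, (m < T)%N -> i \in I -> m + i <= J)%N ->
  `|\sum_(0 <= m < T) correlation (n + m)| <=
  `|block_sum T (block_state g K Q n)| +
  2 * \sum_(0 <= m < T) \sum_(i <- I) (near_integer (n + (m + i)))%:R +
  T%:R * ((high_part (n + J))%:R - (high_part n)%:R).
Proof.
move=> hn TJ.
have triv : `|\sum_(0 <= m < T) correlation (n + m)| <= T%:R.
  apply: le_trans (ler_norm_sum _ _ _) _.
  rewrite -[leRHS](_ : \sum_(0 <= m < T) 1 = T%:R); last by rewrite sumr_const_nat subn0.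
  by apply: ler_sum => m _; rewrite prod_sign_norm.
have near0 : 0 <= \sum_(0 <= m < T) \sum_(i <- I) (near_integer (n + (m + i)))%:R :> R.
  by apply: sumr_ge0 => m _; apply: sumr_ge0.
have lle : (high_part n <= high_part (n + J))%N by apply: lap_le; clear -hn JN; lia.
case: (eqVneq (high_part (n + J)) (high_part n)) => [lapn|lapn]; last first.
  have l1 : 1 <= (high_part (n + J))%:R - (high_part n)%:R :> R.
    by rewrite -natrB // ler1n subn_gt0 ltn_neqAle eq_sym lapn.
  have := ler_wpM2l (ler0n R T) l1; rewrite mulr1.
  by have := normr_ge0 (block_sum T (block_state g K Q n)); lra.
rewrite lapn subrr mulr0 addr0.
pose e := f (high_part n) ^+ size I.
have e1 : `|e| = 1 by rewrite normrX (sign_norm f0 fD fS) expr1n.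
pose B m := \prod_(i <- I) window_sign f mu lam ((block_state g K Q n).1 + (m + i) * (block_state g K Q n).2).
have B1 m : `|B m| = 1.
  by rewrite normr_prod big1 // => i _; apply: (window_sign_norm f0 fD fS).
have -> : `|block_sum T (block_state g K Q n)| = `|e * block_sum T (block_state g K Q n)|.
  by rewrite normrM e1 mul1r.
have mult_diff : `|\sum_(0 <= m < T) correlation (n + m) - e * block_sum T (block_state g K Q n)| <=
    2 * \sum_(0 <= m < T) \sum_(i <- I) (near_integer (n + (m + i)))%:R.
  rewrite /block_sum mulr_sumr -sumrB mulr_sumr.
  apply: le_trans (ler_norm_sum _ _ _) _; apply: ler_sum_nat => m /andP[_ mT].
  case: (boolP (has (fun i => near_integer (n + (m + i))) I)) => [|/hasPn far].
    case/hasP => i iI ni; apply: (@le_trans _ _ 2).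
      apply: le_trans (ler_normB _ _) _.
      by rewrite prod_sign_norm normrM e1 mul1r B1.
    rewrite -[leLHS]mulr1 ler_wpM2l // (big_rem i) //= ni lerDl.
    by apply: sumr_ge0.
  have -> : correlation (n + m) = e * B m.
    have -> : e = \prod_(i <- I) f (high_part n) by rewrite big_const_seq count_predT iter_mulr_1.
    rewrite /correlation /B.
    rewrite -big_split /= big_seq [RHS]big_seq; apply: eq_bigr => i iI.
    rewrite -addnA good_point ?far // ?TJ //; congr (_ * _).
    (* [block_state] keeps the position only modulo 2 ^ (mu + lam), a period of the window sign. *)
    rewrite -(window_sign_mod f mu lam ((_ %% _) + _)%N) expnD modnDml.
    by rewrite -expnD window_sign_mod.
  by rewrite subrr normr0 mulr_ge0 // sumr_ge0.
have := ler_normD (\sum_(0 <= m < T) correlation (n + m) - e * block_sum T (block_state g K Q n))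
  (e * block_sum T (block_state g K Q n)).
by rewrite subrK; lra.
Qed.

Lemma sum_near_le T H : (0 < H)%N -> (H <= N)%N -> 1 <= N%:R * E ->
  (forall m i, (m < T)%N -> i \in I -> m + i <= J)%N ->
  \sum_(N <= n < N + N) \sum_(0 <= m < T) \sum_(i <- I) (near_integer (n + (m + i)))%:R <=
  T%:R * ((size I)%:R * (H%:R + 2 * N%:R / H%:R + H%:R *
     (8 * C1 / c1 * proximity * N%:R + 4 * C1 * H%:R * (N%:R * E)))).
Proof.
move=> H0 HN NE TJ; set X := (X in (size I)%:R * X).
rewrite exchange_big /= mulr_natl.
rewrite -[leRHS](_ : \sum_(0 <= m < T) ((size I)%:R * X) = _); last first.
  by rewrite sumr_const_nat subn0.
apply: ler_sum_nat => m /andP[_ mT]; rewrite exchange_big /=.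
rewrite -[leRHS](_ : \sum_(i <- I) X = _); last first.
  by rewrite big_const_seq count_predT iter_addr_0 mulr_natl.
rewrite big_seq [leRHS]big_seq; apply: ler_sum => i iI.
have prox0 : 0 <= proximity.
  have CE : 0 <= C1 * E by rewrite mulr_ge0 ?(ltW (growth_scale G)) // (le_trans _ (growth_upper G)).
  by apply: addr_ge0; [apply: divr_ge0 | apply: mulr_ge0]; rewrite ?exprn_ge0 // (ltW KR).
apply: le_trans (near_integer_count G H0 HN prox0 NE).
rewrite (@sum_shift R (fun n => (near_integer n)%:R) (m + i)).
have hmi := TJ _ _ mT iI.
rewrite [leRHS](@big_cat_nat _ _ _ (N + (m + i))) ?leq_addr //=; last by clear -hmi JN; lia.
rewrite [X in _ <= _ + X](@big_cat_nat _ _ _ (N + (m + i) + N)) ?leq_addr //=; last by clear -hmi JN; lia.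
by rewrite addrCA lerDl addr_ge0 // sumr_ge0.
Qed.

(** Split into J unit shifts; for each, the sum over n telescopes to the increase of the high part
    over an interval of length N. *)
Lemma sum_lap_le :
  \sum_(N <= n < N + N) ((high_part (n + J))%:R - (high_part n)%:R) <=
  J%:R * (2 * N%:R * (C1 * (N%:R * E)) / Q%:R + 1) :> R.
Proof.
have tele n : (high_part (n + J))%:R - (high_part n)%:R =
    \sum_(0 <= j < J) ((high_part (n + j.+1))%:R - (high_part (n + j))%:R) :> R.
  by rewrite (telescope_sumr (fun j => (high_part (n + j))%:R : R)) // addn0.
under eq_bigr => n _ do rewrite tele.
rewrite exchange_big /= mulr_natl.
set X := (_ / _ + _); rewrite -[leRHS](_ : \sum_(0 <= j < J) X = _); last first.
  by rewrite sumr_const_nat subn0.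
apply: ler_sum_nat => j /andP[_ jJ].
have -> : \sum_(N <= n < N + N) ((high_part (n + j.+1))%:R - (high_part (n + j))%:R) =
   (high_part (N + N + j))%:R - (high_part (N + j))%:R :> R.
  rewrite (eq_bigr (fun n => (high_part (n.+1 + j))%:R - (high_part (n + j))%:R)); last first.
    by move=> n _; rewrite addnS addSn.
  by rewrite (telescope_sumr (fun n => (high_part (n + j))%:R : R)) ?leq_addr.
have gQ n : 0 <= g n / Q%:R by rewrite divr_ge0 ?(growth_ge0 G) ?ltW.
have /andP[a1 a2] := truncn_itv (gQ (N + j)%N).
have /andP[b1 b2] := truncn_itv (gQ (N + N + j)%N).
rewrite -/(high_part _) in a1 a2; rewrite -/(high_part _) in b1 b2; rewrite -natr1 in a2.
have step m : (N + j + m <= 4 * N)%N -> g (N + j + m)%N - g (N + j)%N <= m%:R * (C1 * (N%:R * E)).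
  elim: m => [|m IH] hm; first by rewrite addn0 subrr mul0r.
  have h1 : (N + j + m <= 4 * N)%N by clear -hm; lia.
  have h2 : (N <= N + j + m <= 4 * N)%N by clear -h1; lia.
  have /andP[_] := growth_diff G h2; have := IH h1.
  by rewrite addnS -natr1 mulrDl mul1r; lra.
have hN : (N + j + N <= 4 * N)%N by clear -jJ JN; lia.
have := step N hN; rewrite (addnAC N j N) => sN.
have NC : 0 <= N%:R * (C1 * (N%:R * E)).
  by rewrite !mulr_ge0 ?(ltW (growth_scale G)) // (le_trans _ (growth_upper G)).
have : g (N + N + j)%N / Q%:R - g (N + j)%N / Q%:R <= 2 * N%:R * (C1 * (N%:R * E)) / Q%:R.
  by rewrite -mulrBl ler_wpM2r ?invr_ge0 ?(ltW QR) // (le_trans sN) // -mulrA; lra.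
by rewrite /X; lra.
Qed.

(** The blocks overlap, one starting at every n: shifting the sum by m < T changes it by at most 2 *
    m, and the shifts are added up. Once absolute values are taken, the range Y may be extended to
    N, so partial sums come for free. *)
Lemma sum_blocks_le T Y : (Y <= N)%N ->
  T%:R * `|\sum_(N <= n < N + Y) correlation n| <=
  \sum_(N <= n < N + N) `|\sum_(0 <= m < T) correlation (n + m)| + 2 * T%:R ^+ 2.
Proof.
move=> YN; have corr1 n : `|correlation n| = 1 by exact: prod_sign_norm.
have sumle A B : `|\sum_(A <= n < B) correlation n| <= (B - A)%:R.
  apply: le_trans (ler_norm_sum _ _ _) _.
  rewrite -[leRHS](_ : \sum_(A <= n < B) 1 = _); last by rewrite sumr_const_nat.
  by apply: ler_sum => m _; rewrite corr1.
set S := \sum_(N <= n < N + Y) correlation n.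
have shift m : `|S - \sum_(N <= n < N + Y) correlation (n + m)| <= 2 * m%:R.
  rewrite sum_shift /S.
  have e1 := @big_cat_nat _ 0 (+%R : R -> R -> R) (N + m) N (N + m + Y) xpredT correlation
    (leq_addr _ _) (leq_addr _ _).
  have e2 := @big_cat_nat _ 0 (+%R : R -> R -> R) (N + Y) N (N + m + Y) xpredT correlation
    (leq_addr _ _) ltac:(clear; lia).
  have -> : \sum_(N <= n < N + Y) correlation n - \sum_(N + m <= n < N + m + Y) correlation n =
    \sum_(N <= n < N + m) correlation n - \sum_(N + Y <= n < N + m + Y) correlation n.
    by move: e1; rewrite e2 /= => e; lra.
  apply: le_trans (ler_normB _ _) _.
  have := sumle N (N + m)%N; have := sumle (N + Y)%N (N + m + Y)%N.
  by rewrite addKn (_ : N + m + Y - (N + Y) = m)%N; [lra | clear; lia].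
have -> : T%:R * `|S| = `|\sum_(0 <= m < T) S|.
  by rewrite sumr_const_nat subn0 normrMn mulr_natl.
have -> : \sum_(0 <= m < T) S = \sum_(0 <= m < T) (S - \sum_(N <= n < N + Y) correlation (n + m)) +
   \sum_(N <= n < N + Y) \sum_(0 <= m < T) correlation (n + m).
  by rewrite [X in _ + X]exchange_big -big_split /=; apply: eq_bigr => m _; rewrite subrK.
apply: le_trans (ler_normD _ _) _; rewrite addrC; apply: lerD.
  apply: le_trans (ler_norm_sum _ _ _) _.
  by rewrite [leRHS](@big_cat_nat _ _ _ (N + Y)) ?leq_addr ?leq_add2l //= lerDl sumr_ge0.
apply: le_trans (ler_norm_sum _ _ _) _.
apply: le_trans (_ : \sum_(0 <= m < T) (2 * T%:R) <= _); last first.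
  by rewrite sumr_const_nat subn0 -[_ *+ T]mulr_natr -mulrA expr2 lexx.
apply: ler_sum_nat => m /andP[_ mT]; apply: le_trans (shift m) _.
by rewrite ler_wpM2l // ler_nat ltnW.
Qed.

End Blocks.

(** * Mean square of block sums over all cells *)

Lemma sum_close_le (R : realFieldType) m L T :
  \sum_(0 <= m' < T) ((m < m' + L) && (m' < m + L))%N%:R <= (2 * L)%:R :> R.
Proof.
suff H : \sum_(0 <= m' < T) ((m < m' + L) && (m' < m + L))%N%:R <=
   (minn T (m + L) - (m - L))%:R :> R.
  by apply: le_trans H _; rewrite ler_nat; lia.
elim: T => [|T IH]; first by rewrite big_geq.
rewrite big_nat_recr //=; apply: le_trans (lerD IH (lexx _)) _.
by rewrite -natrD ler_nat; case: ltnP => h1; case: ltnP => h2 /=; lia.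
Qed.

Section SquareSum.
Variables (R : archiRealFieldType) (f : nat -> R).
Hypotheses (f0 : f 0%N = 1) (fD : forall n, f n.*2 = f n)
  (fS : forall n, f n.*2.+1 = - f n).
Variables (mu lam L : nat) (I : seq nat).
Let M := (2 ^ (mu + lam))%N.

Definition pair_forms (m m' : nat) : seq nat := [seq (m + i)%N | i <- I] ++ [seq (m' + i)%N | i <- I].

(** The square expands over pairs (m, m'). The at most 2 * L values m' close to m are estimated
    trivially; for the others the terms |sum over a| are nonnegative, so b may run over the full
    period M instead of B0. *)
Lemma block_sum_sqr_le T B0 X : (B0 <= M)%N -> 0 <= X ->
  (forall m m', (m < T)%N -> (m' < T)%N -> ~~ ((m < m' + L) && (m' < m + L))%N ->
    \sum_(0 <= b < M) `|\sum_(0 <= a < M) \prod_(d <- pair_forms m m') window_sign f mu lam (a + d * b)| <= X) ->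
  \sum_(0 <= a < M) \sum_(0 <= b < B0) block_sum f mu lam I T (a, b) ^+ 2 <=
  T%:R * ((2 * L)%:R * (M%:R * B0%:R) + T%:R * X).
Proof.
move=> BM X0 HX.
pose P m a b := \prod_(i <- I) window_sign f mu lam (a + (m + i) * b).
have P1 m a b : `|P m a b| = 1.
  by rewrite normr_prod big1 // => i _; apply: (window_sign_norm f0 fD fS).
have -> : \sum_(0 <= a < M) \sum_(0 <= b < B0) block_sum f mu lam I T (a, b) ^+ 2 =
  \sum_(0 <= m < T) \sum_(0 <= m' < T) \sum_(0 <= b < B0) \sum_(0 <= a < M) P m a b * P m' a b.
  transitivity (\sum_(0 <= a < M) \sum_(0 <= b < B0) \sum_(0 <= m < T) \sum_(0 <= m' < T) P m a b * P m' a b).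
    apply: eq_bigr => a _; apply: eq_bigr => b _; rewrite expr2 mulr_suml.
    by apply: eq_bigr => m _; rewrite mulr_sumr.
  rewrite exchange_big /=.
  under eq_bigr => b _ do rewrite exchange_big /=.
  rewrite exchange_big /=; apply: eq_bigr => m _.
  under eq_bigr => b _ do rewrite exchange_big /=.
  by rewrite exchange_big.
rewrite mulr_natl -[leRHS](_ : \sum_(0 <= m < T) ((2 * L)%:R * (M%:R * B0%:R) + T%:R * X) = _); last first.
  by rewrite sumr_const_nat subn0.
apply: ler_sum_nat => m /andP[_ mT].
apply: le_trans (_ : \sum_(0 <= m' < T) (((m < m' + L) && (m' < m + L))%N%:R * (M%:R * B0%:R) + X) <= _); last first.
  rewrite big_split /= sumr_const_nat subn0 -[X *+ T]mulr_natl lerD2r -mulr_suml.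
  by rewrite ler_wpM2r ?mulr_ge0 //; apply: sum_close_le.
apply: ler_sum_nat => m' /andP[_ m'T].
apply: le_trans (ler_norm _) _; apply: le_trans (ler_norm_sum _ _ _) _.
case: (boolP ((m < m' + L) && (m' < m + L))%N) => [close|far].
  rewrite mul1r; apply: le_trans (_ : \sum_(0 <= b < B0) M%:R <= _); last first.
    by rewrite sumr_const_nat subn0 -[_ *+ B0]mulr_natr lerDl.
  apply: ler_sum => b _; apply: le_trans (ler_norm_sum _ _ _) _.
  rewrite -[leRHS](_ : \sum_(0 <= a < M) 1 = _); last by rewrite sumr_const_nat subn0.
  by apply: ler_sum => a _; rewrite normrM !P1 mulr1.
rewrite mul0r add0r; apply: le_trans (HX m m' mT m'T far).
rewrite [leRHS](@big_cat_nat _ _ _ B0) //=.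
have -> : \sum_(0 <= b < B0) `|\sum_(0 <= a < M) P m a b * P m' a b| =
  \sum_(0 <= b < B0) `|\sum_(0 <= a < M) \prod_(d <- pair_forms m m') window_sign f mu lam (a + d * b)|.
  apply: eq_bigr => b _; congr `|_|; apply: eq_bigr => a _.
  by rewrite /pair_forms big_cat /= !big_map.
by rewrite lerDl sumr_ge0.
Qed.

Hypotheses (uI : uniq I) (IL : all (fun i => i < L)%N I).

Lemma pair_forms_uniq m m' : ~~ ((m < m' + L) && (m' < m + L))%N -> uniq (pair_forms m m').
Proof.
move=> far; rewrite cat_uniq !map_inj_uniq ?uI /=; try by move=> x y; lia.
rewrite andbT; apply/hasPn => d /mapP[i' i'I ->]; apply/mapP => -[i iI].
have iL := allP IL i iI; have i'L := allP IL i' i'I.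
by clear -far iL i'L => e; lia.
Qed.

Lemma pair_forms_size m m' : size (pair_forms m m') = (2 * size I)%N.
Proof. by rewrite size_cat !size_map mul2n addnn. Qed.

Lemma pair_forms_le T m m' : (m < T)%N -> (m' < T)%N ->
  all (fun d => d <= T + L)%N (pair_forms m m').
Proof.
move=> mT m'T; rewrite all_cat !all_map; apply/andP; split.
all: by apply/allP => i /(allP IL) /= iL; clear -iL mT m'T; lia.
Qed.

End SquareSum.

Section PairDecay.
Variables (R : archiRealFieldType) (f : nat -> R).
Hypotheses (f0 : f 0%N = 1) (fD : forall n, f n.*2 = f n)
  (fS : forall n, f n.*2.+1 = - f n).
Variables (L : nat) (I : seq nat).
Hypotheses (uI : uniq I) (IL : all (fun i => i < L)%N I) (I0 : (0 < size I)%N).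

Lemma pair_forms_decay : exists B : nat, forall rho mu lam m m',
  (0 < rho)%N -> (B * rho <= lam)%N ->
  (m < 4 ^ rho)%N -> (m' < 4 ^ rho)%N -> ~~ ((m < m' + L) && (m' < m + L))%N ->
  \sum_(0 <= b < 2 ^ (mu + lam)) `|\sum_(0 <= a < 2 ^ (mu + lam))
     \prod_(d <- pair_forms I m m') window_sign f mu lam (a + d * b)| <=
  (2 ^ (mu + lam))%:R ^+ 2 * (2 ^+ (6 * rho))^-1.
Proof.
have [k kE] : exists k, (2 * size I = k.+1)%N by exists (2 * size I).-1; lia.
have k1 : (1 <= k)%N by lia.
(* The first summand leaves 2 ^ (6 * rho) after the root of order 2 ^ k.+1; the second pays for the
   loss J ^ (2 * k) at J = 2 ^ ((L + 2) * rho), which is at least 4 ^ rho + L. *)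
pose a := (6 * 2 ^ k.+1 + (L + 2) * (2 * k))%N.
have [B HB] := linear_forms_decay f0 fD fS a k1.
exists B.+1 => rho mu lam m m' rho0 hlam mT m'T far.
set S := \sum_(_ <= _ < _) _; set M : R := (2 ^ (mu + lam))%:R.
have M0 : 0 < M ^+ 2 by rewrite exprn_gt0 // ltr0n expn_gt0.
have h1 : (B * rho <= lam)%N by apply: leq_trans hlam; rewrite leq_mul2r leqnSn orbT.
have h2 : (0 < mu + lam)%N by clear -hlam rho0; nia.
have := HB rho mu lam (2 ^ ((L + 2) * rho))%N (pair_forms I m m') h1 h2.
have U : uniq (pair_forms I m m') by apply: pair_forms_uniq far.
rewrite pair_forms_size kE => /(_ erefl U).
have Dle : all (fun d => d <= 2 ^ ((L + 2) * rho))%N (pair_forms I m m').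
  have Dle : all (fun d => d <= 4 ^ rho + L)%N (pair_forms I m m') by apply: pair_forms_le.
  apply/allP => d /(allP Dle) /= /leq_trans; apply.
  have l1 : (L < 2 ^ (L * rho))%N.
    by apply: leq_trans (ltn_expl L (isT : 1 < 2)%N) _; rewrite leq_exp2l // leq_pmulr.
  have l2 : (4 ^ rho = 2 ^ (2 * rho))%N by rewrite expnM.
  rewrite l2 mulnDl expnD.
  have e1 : (0 < 2 ^ (L * rho))%N by rewrite expn_gt0.
  have e2 : (4 <= 2 ^ (2 * rho))%N by rewrite -[4%N]/(2 ^ 2)%N leq_exp2l //; lia.
  by clear -l1 e1 e2; nia.
move=> /(_ Dle); rewrite -/S -/M => H.
have {}H : ((M ^+ 2)^-1 * S) ^+ (2 ^ k.+1) <= ((2 ^+ (6 * rho))^-1) ^+ (2 ^ k.+1).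
  apply: le_trans H _; rewrite natrX exprVn -!exprM le_eqVlt; apply/orP; left.
  have -> : (a * rho = (L + 2) * rho * (2 * k) + 6 * rho * 2 ^ k.+1)%N by rewrite /a; ring.
  by rewrite exprD invfM mulrA mulfV ?mul1r // gt_eqF // exprn_gt0.
have S0 : 0 <= S by rewrite sumr_ge0.
have SM0 : 0 <= (M ^+ 2)^-1 * S by rewrite mulr_ge0 // invr_ge0 ltW.
move: H; rewrite ler_pXn2r ?nnegrE ?invr_ge0 ?exprn_ge0 ?expn_gt0 //.
by rewrite ler_pdivrMl.
Qed.

End PairDecay.

Lemma ex_pow2_between (R : archiRealFieldType) (x : R) : 1 <= x ->
  exists l : nat, x <= 2 ^+ l <= 2 * x.
Proof.
move=> x1; have ex : exists n : nat, x <= 2 ^+ n.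
  exists (Num.truncn x).+1; apply: le_trans (ltW (truncnS_gt x)) _.
  by rewrite -natrX ler_nat ltnW // ltn_expl.
case: (ex_minnP ex) => -[|n] xn nmin.
  by exists 0%N; rewrite xn expr0 /=; lra.
exists n.+1; rewrite xn exprS ler_pM2l //=.
by case: (leP x (2 ^+ n)) => [/nmin|/ltW //]; rewrite ltnn.
Qed.

(** * Numerical inequalities for the choice of parameters *)

Section Numerics.
Variable R : realFieldType.

(** With x = N and D = N * E: changes of the high part cost only a proportion 1 / q. *)
Lemma lap_numerics (L q x D C1 Q J : R) : 0 <= L -> 1 <= q -> 0 < D -> 1 <= C1 -> 0 <= J ->
  D * q ^+ 4 <= Q -> J <= (L + 1) * q ^+ 2 -> q ^+ 3 <= x ->
  J * (2 * x * (C1 * D) / Q + 1) <= (L + 1) * (2 * C1 + 1) * (x / q).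
Proof.
move=> L0 q1 D0 C11 J0 DQ JL qx.
have q0 : 0 < q by lra.
have x0 : 0 < x by apply: lt_le_trans qx; rewrite exprn_gt0.
have C10 : 0 < C1 by lra.
have Q0 : 0 < Q by apply: lt_le_trans DQ; rewrite mulr_gt0 ?exprn_gt0.
have h1 : 2 * x * (C1 * D) / Q <= 2 * C1 * x / q ^+ 4.
  rewrite ler_pdivrMr // [leRHS]mulrAC ler_pdivlMr ?exprn_gt0 //.
  have -> : 2 * x * (C1 * D) * q ^+ 4 = 2 * C1 * x * (D * q ^+ 4) by ring.
  by rewrite ler_pM2l ?mulr_gt0.
have h2 : 0 <= 2 * C1 * x / q ^+ 4 + 1.
  by rewrite addr_ge0 // divr_ge0 ?exprn_ge0 ?mulr_ge0 // ltW.
have h3 : 0 <= 2 * x * (C1 * D) / Q + 1.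
  by rewrite addr_ge0 // divr_ge0 ?mulr_ge0 // ltW.
apply: le_trans (_ : (L + 1) * q ^+ 2 * (2 * C1 * x / q ^+ 4 + 1) <= _).
  by apply: ler_pM => //; rewrite lerD2r.
rewrite -mulrA -[leRHS]mulrA ler_wpM2l //; first by lra.
have -> : q ^+ 2 * (2 * C1 * x / q ^+ 4 + 1) = 2 * C1 * (x / q / q) + q ^+ 2.
  by field; rewrite gt_eqF.
have z0 : 0 <= x / q by rewrite divr_ge0 // ltW.
have h4 : q ^+ 2 <= x / q by rewrite ler_pdivlMr // -exprSr.
have h5 : x / q / q <= x / q by rewrite ler_pdivrMr // ler_peMr.
have -> : (2 * C1 + 1) * (x / q) = 2 * C1 * (x / q) + x / q by ring.
by apply: lerD => //; rewrite ler_wpM2l //; lra.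
Qed.

(** The bound of [near_integer_count] at H = q and K = q ^ 4. The proximity has order q ^ -2, so H =
    q balances x / H against H times proximity times x. *)
Lemma near_numerics (L q x E C1 c1 J : R) : 0 <= L -> 1 <= q -> 0 < E -> 1 <= C1 -> 0 < c1 ->
  0 <= J -> J <= (L + 1) * q ^+ 2 -> E * q ^+ 6 <= 1 -> q ^+ 3 <= x ->
  q + 2 * x / q + q * (8 * C1 / c1 * ((1 + J) / q ^+ 4 + J ^+ 2 * (C1 * E)) * x + 4 * C1 * q * (x * E))
  <= (3 + 8 * C1 / c1 * ((L + 2) + (L + 1) ^+ 2 * C1) + 4 * C1) * (x / q).
Proof.
move=> L0 q1 E0 C11 c10 J0 JL Eq qx.
have q0 : 0 < q by lra.
have x0 : 0 < x by apply: lt_le_trans qx; rewrite exprn_gt0.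
have C10 : 0 < C1 by lra.
have z0 : 0 < x / q by rewrite divr_gt0.
have q2 : 1 <= q ^+ 2 by rewrite exprn_ege1.
have h0 : q <= x / q.
  rewrite ler_pdivlMr // -expr2; apply: le_trans qx.
  by rewrite [leRHS]exprS ler_peMl // exprn_ge0 // ltW.
pose c3 := (L + 2) + (L + 1) ^+ 2 * C1.
have prox : (1 + J) / q ^+ 4 + J ^+ 2 * (C1 * E) <= c3 / q ^+ 2.
  rewrite /c3 [leRHS]mulrDl; apply: lerD.
    rewrite ler_pdivrMr ?exprn_gt0 //.
    have -> : (L + 2) / q ^+ 2 * q ^+ 4 = (L + 2) * q ^+ 2 by field; rewrite gt_eqF.
    by have : (L + 2) * q ^+ 2 = (L + 1) * q ^+ 2 + q ^+ 2 by [ring]; lra.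
  rewrite ler_pdivlMr ?exprn_gt0 //.
  apply: le_trans (_ : ((L + 1) * q ^+ 2) ^+ 2 * (C1 * E) * q ^+ 2 <= _).
    rewrite ler_wpM2r ?exprn_ge0 ?(ltW q0) // ler_wpM2r ?mulr_ge0 ?(ltW C10) ?(ltW E0) //.
    by rewrite lerXn2r ?nnegrE //; apply: le_trans JL.
  have -> : ((L + 1) * q ^+ 2) ^+ 2 * (C1 * E) * q ^+ 2 = (L + 1) ^+ 2 * C1 * (E * q ^+ 6) by ring.
  by rewrite ler_piMr // mulr_ge0 ?sqr_ge0 // ltW.
have h1 : q * (8 * C1 / c1 * ((1 + J) / q ^+ 4 + J ^+ 2 * (C1 * E)) * x) <=
   8 * C1 / c1 * c3 * (x / q).
  have -> : 8 * C1 / c1 * c3 * (x / q) = q * (8 * C1 / c1 * (c3 / q ^+ 2) * x).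
    by field; rewrite !gt_eqF.
  rewrite ler_pM2l // ler_pM2r // ler_pM2l // divr_gt0 // mulr_gt0 //.
have h2 : q * (4 * C1 * q * (x * E)) <= 4 * C1 * (x / q).
  have -> : q * (4 * C1 * q * (x * E)) = 4 * C1 * (x * (q ^+ 2 * E)) by ring.
  rewrite ler_pM2l ?mulr_gt0 // ler_pM2l // -[leRHS]mul1r ler_pdivlMr //.
  apply: le_trans Eq; have -> : q ^+ 2 * E * q = E * q ^+ 3 by ring.
  by rewrite ler_pM2l // ler_weXn2l.
rewrite -/c3 mulrDr; have -> : 2 * x / q = 2 * (x / q) by rewrite mulrA.
by rewrite !mulrDl; lra.
Qed.

(** The choice of t balances the two sides: t * En and W2 / t both have order q * x, a factor q
    below the trivial bound for blocks of length q ^ 2. *)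
Lemma energy_numerics (L q x E C1 C2 Q t B0 En W2 W : R) : 0 <= L -> 1 <= q -> 0 < x -> 0 < E ->
  1 <= C1 -> 0 < Q -> Q <= 2 * (x * E) * q ^+ 4 ->
  C1 * (x * E) * q ^+ 4 <= B0 -> B0 <= 2 * (C1 * (x * E) * q ^+ 4) ->
  t = q ^+ 9 * Q * E ->
  En <= C2 * (x / ((q ^+ 4) ^+ 2 * Q * E)) ->
  W2 <= q ^+ 2 * (2 * L * (q ^+ 4 * Q * B0) + q ^+ 2 * ((q ^+ 4 * Q) ^+ 2 / q ^+ 6)) ->
  2 * W <= t * En + t^-1 * W2 ->
  2 * W <= (C2 + (2 * L + 2) * (2 * (2 * C1))) * (q * x).
Proof.
move=> L0 q1 x0 E0 C11 Q0 QE B1 B2 tE hEn hW2 hW.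
have q0 : 0 < q by lra.
have qn n : 0 < q ^+ n by rewrite exprn_gt0.
have C10 : 0 < C1 by lra.
have t0 : 0 < t by rewrite tE !mulr_gt0.
have xE : 0 < x * E by rewrite mulr_gt0.
have h1 : t * En <= C2 * (q * x).
  have -> : C2 * (q * x) = t * (C2 * (x / ((q ^+ 4) ^+ 2 * Q * E))).
    by rewrite tE; field; rewrite !gt_eqF.
  by rewrite ler_pM2l.
have h2 : W2 <= q ^+ 2 * ((2 * L + 2) * (q ^+ 4 * Q * B0)).
  apply: le_trans hW2 _; rewrite ler_pM2l //.
  have -> : (2 * L + 2) * (q ^+ 4 * Q * B0) = 2 * L * (q ^+ 4 * Q * B0) + 2 * (q ^+ 4 * Q * B0) by ring.
  rewrite lerD2l.
  have -> : q ^+ 2 * ((q ^+ 4 * Q) ^+ 2 / q ^+ 6) = q ^+ 4 * Q * Q by field; rewrite gt_eqF.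
  have -> : 2 * (q ^+ 4 * Q * B0) = q ^+ 4 * Q * (2 * B0) by ring.
  rewrite ler_pM2l ?mulr_gt0 //; apply: le_trans QE _.
  rewrite -mulrA ler_pM2l //; apply: le_trans B1.
  by rewrite -!mulrA ler_peMl // mulr_ge0 ?(ltW x0) ?mulr_ge0 // ltW.
have h3 : t^-1 * W2 <= (2 * L + 2) * (2 * (2 * C1)) * (q * x).
  rewrite mulrC ler_pdivrMr //; apply: le_trans h2 _.
  have -> : (2 * L + 2) * (2 * (2 * C1)) * (q * x) * t =
    q ^+ 2 * ((2 * L + 2) * (q ^+ 4 * Q * (2 * (2 * (C1 * (x * E) * q ^+ 4))))).
    by rewrite tE; ring.
  rewrite ler_pM2l // ler_wpM2l //; first by lra.
  rewrite ler_pM2l ?mulr_gt0 //; apply: le_trans B2 _.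
  by rewrite ler_peMl // ?mulr_ge0 ?(ltW C10) ?(ltW xE) ?(ltW (qn _)) //; lra.
by rewrite [leRHS]mulrDl; apply: le_trans hW (lerD h1 h3).
Qed.
End Numerics.

(** * Correlations of sequences with controlled second differences *)

Section CorrelationBound.
Variables (R : archiRealFieldType) (f : nat -> R).
Hypotheses (f0 : f 0%N = 1) (fD : forall n, f n.*2 = f n)
  (fS : forall n, f n.*2.+1 = - f n).
Variables (L : nat) (I : seq nat).
Hypotheses (uI : uniq I) (IL : all (fun i => i < L)%N I) (I0 : (0 < size I)%N).

(** The block length is 4 ^ rho = q ^ 2, the mesh q ^ -4, and Q = 2 ^ lam has order N * E * q ^ 4.
    The condition N * E ^ 2 * q ^ 13 <= 1 keeps the number of cells at about N; for E = N ^ (c - 2)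
    it is where c < 3 / 2 enters. *)
Lemma sum_block_sums_le (g : nat -> R) (N : nat) (c1 C1 E : R) rho lam :
  growth g N c1 C1 E -> (0 < rho)%N ->
  let q : R := 2 ^+ rho in
  2 * C1 <= q -> 1 <= N%:R * E -> 2 ^+ lam <= 2 * (N%:R * E) * q ^+ 4 ->
  N%:R * E * q ^+ 4 <= 2 ^+ lam -> N%:R * E ^+ 2 * q ^+ 13 <= 1 ->
  (forall m m', (m < 4 ^ rho)%N -> (m' < 4 ^ rho)%N -> ~~ ((m < m' + L) && (m' < m + L))%N ->
  \sum_(0 <= b < 2 ^ (rho * 4 + lam)) `|\sum_(0 <= a < 2 ^ (rho * 4 + lam))
     \prod_(d <- pair_forms I m m') window_sign f (rho * 4) lam (a + d * b)| <=
  (2 ^ (rho * 4 + lam))%:R ^+ 2 * (2 ^+ (6 * rho))^-1) ->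
  2 * \sum_(N <= n < N + N) `|block_sum f (rho * 4) lam I (4 ^ rho) (block_state g (2 ^ (rho * 4)) (2 ^ lam) n)|
  <= (1 + 18 * C1 / c1 ^+ 2 + 24 / c1 + (2 * L%:R + 2) * (2 * (2 * C1))) * (q * N%:R).
Proof.
move=> G rho0 q C1q NE1 Qup Qlo small decay.
have [E0 C11 c10] := And3 (growth_scale G) (growth_upper G) (growth_lower G).
have C10 : 0 < C1 by apply: lt_le_trans C11.
set K := (2 ^ (rho * 4))%N; set Q := (2 ^ lam)%N.
have KE : K%:R = q ^+ 4 :> R by rewrite natrX exprM.
have QE : Q%:R = 2 ^+ lam :> R by rewrite natrX.
have q2 : 2 <= q by rewrite -[leLHS]expr1 ler_weXn2l // ler1n.
have q0 : 0 < q by lra.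
have x0 : 0 < N%:R :> R by rewrite -(pmulr_lgt0 _ E0); apply: lt_le_trans NE1.
have Q0 : 0 < Q%:R :> R by rewrite ltr0n expn_gt0.
have D0 : 0 < C1 * (N%:R * E) * K%:R by rewrite !mulr_gt0 // KE exprn_gt0.
have D1 : 1 <= C1 * (N%:R * E) * K%:R.
  by apply: mulr_ege1; [apply: mulr_ege1 | rewrite KE exprn_ege1 //; lra].
(* [B0] exceeds every slope that occurs, and 2 * C1 <= q keeps it within the period 2 ^ (rho * 4 +
   lam). *)
pose B0 := (Num.truncn (C1 * (N%:R * E) * K%:R)).+1.
have B1 : C1 * (N%:R * E) * q ^+ 4 <= B0%:R by rewrite -KE ltW // truncnS_gt.
have B2 : B0%:R <= 2 * (C1 * (N%:R * E) * q ^+ 4).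
  rewrite -KE /B0 -[leLHS]natr1; have := truncn_itv (ltW D0) => /andP[h _].
  by move: (C1 * _ * _) D1 h => z; lra.
have ME : (2 ^ (rho * 4 + lam))%:R = q ^+ 4 * Q%:R :> R.
  by rewrite expnD natrM KE.
have B0M : (B0 <= 2 ^ (rho * 4 + lam))%N.
  rewrite -(ler_nat R) ME; apply: le_trans B2 _; rewrite QE.
  rewrite [leRHS]mulrC; have -> : 2 * (C1 * (N%:R * E) * q ^+ 4) = 2 * C1 * (N%:R * E) * q ^+ 4 by ring.
  rewrite ler_pM2r ?exprn_gt0 //; apply: le_trans Qlo.
  rewrite mulrC ler_pM2l ?mulr_gt0 //; apply: le_trans C1q _.
  by rewrite -[leLHS]expr1 ler_weXn2l //; lra.
pose s := [seq (a, b) | a <- iota 0 (2 ^ (rho * 4 + lam)), b <- iota 0 B0].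
have us : uniq s.
  by apply: allpairs_uniq; rewrite ?iota_uniq // => -[a b] [a' b'] _ _ /= [-> ->].
have ps n : (N <= n < N + N)%N -> block_state g K Q n \in s.
  move=> hn; apply/allpairsP; exists (block_state g K Q n); split; last by case: (block_state _ _ _ _).
    by rewrite mem_iota /= add0n expnD ltn_mod muln_gt0 !expn_gt0.
  rewrite mem_iota /= add0n ltnS; apply: le_truncn.
  have n4 : (N <= n <= 4 * N)%N by clear -hn; lia.
  by have /andP[_ h] := growth_diff G n4; rewrite ler_wpM2r.
pose t := q ^+ 9 * Q%:R * E.
have t0 : 0 < t by rewrite !mulr_gt0 ?exprn_gt0.
pose W p := `|block_sum f (rho * 4) lam I (4 ^ rho) p|.
have hW := sum_le_energy us ps W t0.
have hE : \sum_(N <= n < N + N) \sum_(N <= n' < N + N) (block_state g K Q n == block_state g K Q n')%:R <=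
  (1 + 18 * C1 / c1 ^+ 2 + 24 / c1) * (N%:R / ((q ^+ 4) ^+ 2 * Q%:R * E)).
  rewrite -KE; apply: (energy_le G); rewrite ?expn_gt0 //.
    apply: le_trans small; rewrite KE QE.
    apply: le_trans (_ : 2 * (N%:R * E) * q ^+ 4 * E * (q ^+ 4) ^+ 2 <= _).
      by rewrite ler_wpM2r ?exprn_ge0 ?(ltW q0) // ler_wpM2r ?(ltW E0).
    have -> : 2 * (N%:R * E) * q ^+ 4 * E * (q ^+ 4) ^+ 2 = N%:R * E ^+ 2 * q ^+ 12 * 2 by ring.
    by rewrite [q ^+ 13]exprSr [leRHS]mulrA ler_wpM2l // !mulr_ge0 ?exprn_ge0 // ltW.
  by rewrite KE QE.
have TE : (4 ^ rho)%:R = q ^+ 2 :> R.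
  by rewrite natrX /q exprAC; congr (_ ^+ _); ring.
have hW2 : \sum_(p <- s) W p ^+ 2 <=
   q ^+ 2 * (2 * L%:R * (q ^+ 4 * Q%:R * B0%:R) + q ^+ 2 * ((q ^+ 4 * Q%:R) ^+ 2 / q ^+ 6)).
  have X0 : 0 <= (2 ^ (rho * 4 + lam))%:R ^+ 2 * (2 ^+ (6 * rho))^-1 :> R.
    by rewrite mulr_ge0 ?invr_ge0 ?exprn_ge0.
  have := block_sum_sqr_le f0 fD fS B0M X0 decay.
  rewrite TE ME natrM [(6 * rho)%N]mulnC exprM -/q /s big_allpairs_dep /index_iota !subn0.
  by apply: le_trans; rewrite le_eqVlt; apply/orP; left; apply/eqP;
    apply: eq_bigr => a _; apply: eq_bigr => b _; rewrite /W real_normK ?num_real.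
apply: (energy_numerics (L := L%:R) (C1 := C1) (E := E) (Q := Q%:R) (t := t)
  (B0 := B0%:R) _ _ x0 E0 C11 Q0 _ B1 B2 erefl hE hW2 hW) => //; first by lra.
by rewrite QE.
Qed.

(** The sum times q ^ 2 is bounded by the sum over blocks. Block sums, points near integers, changes
    of the high part and the ends of the range each contribute O(q ^ 2 * N / q). *)
Lemma correlation_bound (c1 C1 : R) : exists (B : nat) (C : R),
  forall (g : nat -> R) (N : nat) (E : R) (rho : nat),
  growth g N c1 C1 E -> (0 < rho)%N ->
  2 * C1 <= 2 ^+ rho -> (2 ^+ rho) ^+ B <= N%:R * E -> N%:R * E ^+ 2 * (2 ^+ rho) ^+ 13 <= 1 ->
  forall Y, (Y <= N)%N ->
  `|\sum_(N <= n < N + Y) correlation f g I n| <= C * (N%:R / 2 ^+ rho).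
Proof.
have [B HB] := pair_forms_decay f0 fD fS uI IL I0.
pose CW := 1 + 18 * C1 / c1 ^+ 2 + 24 / c1 + (2 * L%:R + 2) * (2 * (2 * C1)).
pose CX := 3 + 8 * C1 / c1 * ((L%:R + 2) + (L%:R + 1) ^+ 2 * C1) + 4 * C1.
pose CJ := (L%:R + 1) * (2 * C1 + 1).
(* The summand B yields B * rho <= lam for the decay; L + 4 yields q ^ (L + 4) <= N, hence J <= N
   and q ^ 3 <= N. *)
exists (B + L + 4)%N, (CW + 2 * ((size I)%:R * CX) + CJ + 2).
move=> g N E rho G rho0; set q : R := 2 ^+ rho => C1q qB small Y YN.
have [E0 C11 c10] := And3 (growth_scale G) (growth_upper G) (growth_lower G).
have C10 : 0 < C1 by apply: lt_le_trans C11.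
have q2 : 2 <= q by rewrite -[leLHS]expr1 ler_weXn2l // ler1n.
have q1 : 1 <= q by lra.
have q0 : 0 < q by lra.
have qn n : 0 < q ^+ n by rewrite exprn_gt0.
have NE1 : 1 <= N%:R * E by apply: le_trans qB; rewrite exprn_ege1.
have x0 : 0 < N%:R :> R by rewrite -(pmulr_lgt0 _ E0); apply: lt_le_trans NE1.
have Eq13 : E * q ^+ 13 <= 1.
  apply: le_trans small; rewrite expr2 mulrA -[leLHS]mul1r -[leRHS]mulrA.
  by rewrite ler_wpM2r // mulr_ge0 // ltW.
have E1 : E <= 1.
  by apply: le_trans Eq13; rewrite ler_peMr ?(ltW E0) // exprn_ege1.
have Eq6 : E * q ^+ 6 <= 1.
  by apply: le_trans Eq13; rewrite ler_pM2l // ler_weXn2l.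
have NEN : N%:R * E <= N%:R by rewrite ler_piMr // ltW.
have qL4 : q ^+ (L + 4) <= N%:R.
  by apply: le_trans NEN; apply: le_trans qB; rewrite ler_weXn2l // -addnA leq_addl.
have q3 : q ^+ 3 <= N%:R.
  by apply: le_trans qL4; rewrite ler_weXn2l // addnC.
have X1 : 1 <= N%:R * E * q ^+ 4 by apply: mulr_ege1 => //; apply: exprn_ege1.
have [lam /andP[Qlo Qup]] := ex_pow2_between X1; rewrite mulrA in Qup.
have hlam : (B * rho <= lam)%N.
  have : q ^+ B <= 2 ^+ lam.
    apply: le_trans Qlo; apply: le_trans (_ : N%:R * E <= _); last first.
      by apply: ler_peMr; [exact: le_trans NE1 | exact: exprn_ege1].
    by apply: le_trans qB; rewrite ler_weXn2l // -addnA leq_addr.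
  by rewrite /q -exprM mulnC ler_eXn2l // ltr1n.
have decay := fun m m' => HB rho (rho * 4)%N lam m m' rho0 hlam.
have hS := sum_block_sums_le G rho0 C1q NE1 Qup Qlo small decay.
have TE : (4 ^ rho)%:R = q ^+ 2 :> R.
  by rewrite natrX /q exprAC; congr (_ ^+ _); ring.
pose J := (4 ^ rho + L)%N.
have LqL : L.+1%:R <= q ^+ L.
  rewrite /q -exprM -natrX ler_nat; apply: leq_trans (ltn_expl L (isT : 1 < 2)%N) _.
  by rewrite leq_exp2l // leq_pmull.
have Jq : J%:R <= (L%:R + 1) * q ^+ 2.
  rewrite natrD TE mulrDl mul1r addrC lerD2r.
  by apply: ler_peMr => //; apply: exprn_ege1.
have JN : (J <= N)%N.
  rewrite -(ler_nat R); apply: le_trans Jq _; apply: le_trans qL4.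
  rewrite natr1 exprD; apply: ler_pM => //; first by rewrite exprn_ge0 // ltW.
  by rewrite ler_weXn2l.
have TJ m i : (m < 4 ^ rho)%N -> i \in I -> (m + i <= J)%N.
  by move=> mT iI; have := allP IL i iI; rewrite /J; clear -mT; lia.
have hK : (2 ^ (rho * 4))%:R = q ^+ 4 :> R by rewrite natrX exprM.
have H0 : (0 < 2 ^ rho)%N by rewrite expn_gt0.
have HN : (2 ^ rho <= N)%N.
  rewrite -(ler_nat R) natrX -/q; apply: le_trans q3.
  by rewrite -[leLHS]expr1 ler_weXn2l.
have hnear := sum_near_le G (rho * 4) JN H0 HN NE1 TJ.
have hlap := sum_lap_le G lam JN.
have hblk := sum_blocks_le f0 fD fS g I (4 ^ rho) YN.
set S := \sum_(N <= n < N + Y) _ in hblk *.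
have sumb : \sum_(N <= n < N + N) `|\sum_(0 <= m < 4 ^ rho) correlation f g I (n + m)| <=
  \sum_(N <= n < N + N) `|block_sum f (rho * 4) lam I (4 ^ rho) (block_state g (2 ^ (rho * 4)) (2 ^ lam) n)| +
  2 * (\sum_(N <= n < N + N) \sum_(0 <= m < 4 ^ rho) \sum_(i <- I) (near_integer g C1 E (rho * 4) J (n + (m + i)))%:R) +
  (4 ^ rho)%:R * (\sum_(N <= n < N + N) ((high_part g lam (n + J))%:R - (high_part g lam n)%:R)).
  rewrite !mulr_sumr -!big_split /=; apply: ler_sum_nat => n hn.
  apply: (block_le f0 fD fS G) => //; clear -hn; lia.
have nnum := near_numerics (ler0n R L) q1 E0 C11 c10 (ler0n R J) Jq Eq6 q3.
have lnum := lap_numerics (ler0n R L) q1 (lt_le_trans ltr01 NE1) C11 (ler0n R J) Qlo Jq q3.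
have z0 : 0 < N%:R / q by rewrite divr_gt0.
have q2z : q ^+ 2 <= N%:R / q by rewrite ler_pdivlMr // -exprSr.
have hq : (2 ^ rho)%:R = q :> R by rewrite natrX.
rewrite /proximity hK hq TE (natrD _ 1 J) in hnear.
rewrite natrX in hlap.
rewrite TE in hblk sumb.
have nn : q ^+ 2 * ((size I)%:R * (q + 2 * N%:R / q + q * (8 * C1 / c1 *
    ((1 + J%:R) / q ^+ 4 + J%:R ^+ 2 * (C1 * E)) * N%:R + 4 * C1 * q * (N%:R * E)))) <=
    q ^+ 2 * ((size I)%:R * (CX * (N%:R / q))).
  by rewrite ler_pM2l // ler_wpM2l.
have ll := le_trans hlap lnum.
have {}ll := ler_wpM2l (ltW (qn 2%N)) ll.
have qN : q * N%:R = q ^+ 2 * (N%:R / q) by field; rewrite gt_eqF.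
rewrite qN in hS.
rewrite -(ler_pM2l (qn 2%N)); apply: le_trans hblk _.
have q4 : 2 * (q ^+ 2) ^+ 2 <= 2 * (q ^+ 2 * (N%:R / q)).
  by rewrite ler_pM2l // [(q ^+ 2) ^+ 2]expr2 ler_pM2l.
have W0 : 0 <= \sum_(N <= n < N + N) `|block_sum f (rho * 4) lam I (4 ^ rho) (block_state g (2 ^ (rho * 4)) (2 ^ lam) n)|.
  by apply: sumr_ge0.
have := le_trans hnear nn; rewrite -/CW in hS.
move: sumb ll hS q4 W0; rewrite -/CJ.
set a1 := \sum_(_ <= _ < _) _; set a2 := \sum_(_ <= _ < _) _; set a3 := \sum_(_ <= _ < _) _.
set a4 := \sum_(_ <= _ < _) _.
move: (N%:R / q) => z; move: (q ^+ 2) => y; clear => *.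
have -> : y * ((CW + 2 * ((size I)%:R * CX) + CJ + 2) * z) =
  CW * (y * z) + 2 * (y * ((size I)%:R * (CX * z))) + y * (CJ * z) + 2 * (y * z) by ring.
by lra.
Qed.

End CorrelationBound.

(** * Powers and the Thue-Morse sequence *)

Local Open Scope classical_set_scope.
Local Open Scope ring_scope.

Section PowerGrowth.
Variable R : realType.
Implicit Types (a b c s x : R).

Lemma MVT_derivable (f df : R -> R) a b : a < b ->
  (forall x, a <= x -> is_derive x 1 f (df x)) ->
  exists2 x, a < x < b & f b - f a = df x * (b - a).
Proof.
move=> ab fd.
have fd' x : x \in `]a, b[ -> is_derive x 1 f (df x).
  by rewrite in_itv /= => /andP[/ltW ax _]; apply: fd.
have fc : {within `[a, b], continuous f}.
  apply: derivable_within_continuous => x; rewrite in_itv /= => /andP[ax _].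
  exact: (@ex_derive _ _ _ _ _ _ _ (fd x ax)).
have [x xab E] := MVT ab fd' fc.
by exists x => //; move: xab; rewrite in_itv.
Qed.

Lemma powR_MVT s a b : 0 < a -> a < b ->
  exists2 x, a < x < b & b `^ s - a `^ s = s * x `^ (s - 1) * (b - a).
Proof.
move=> a0 ab; apply: (@MVT_derivable (fun t => t `^ s) (fun t => s * t `^ (s - 1))) => // x ax.
by apply: is_derive1_powR; apply: lt_le_trans ax.
Qed.

(** The mean value theorem for h t = (t + 1) ^ s - t ^ s, and then for the power s - 1 in its
    derivative. *)
Lemma powR_diff2_MVT s a : 0 < a -> exists2 x, a < x < a + 2 &
  ((a + 2) `^ s - (a + 1) `^ s) - ((a + 1) `^ s - a `^ s) = s * (s - 1) * x `^ (s - 2).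
Proof.
move=> a0.
pose h t := (t + 1) `^ s - t `^ s.
have hd x : a <= x -> is_derive x 1 h (s * (x + 1) `^ (s - 1) - s * x `^ (s - 1)).
  move=> ax; have x0 : 0 < x by apply: lt_le_trans ax.
  have x1 : 0 < x + 1 by lra.
  have d1 := is_derive1_powR s x0.
  have d2 := @is_derive1_comp R (fun t => t `^ s) (shift 1) x _ 1 (is_derive1_powR s x1)
    (is_derive_shift x 1 1).
  rewrite mulr1 in d2.
  exact: is_deriveB.
have [x /andP[ax xa] hE] := MVT_derivable (ltac:(lra) : a < a + 1) hd.
have x0 : 0 < x by apply: lt_trans ax.
have [y /andP[xy yx] yE] := powR_MVT (s - 1) x0 (ltac:(lra) : x < x + 1).
exists y; first by apply/andP; split; lra.
have e1 : x + 1 - x = 1 by ring.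
have e2 : a + 1 - a = 1 by ring.
have e3 : s - 1 - 1 = s - 2 by ring.
have e4 : a + 1 + 1 = a + 2 by ring.
move: hE; rewrite /h e2 e4 mulr1 => ->.
by rewrite -mulrBr yE e1 mulr1 e3 mulrA.
Qed.

Lemma le_powR_exp_neg s x y : s <= 0 -> 0 < x -> x <= y -> y `^ s <= x `^ s.
Proof.
move=> s0 x0 xy; have y0 : 0 < y by apply: lt_le_trans xy.
have : x `^ (- s) <= y `^ (- s).
  by apply: ge0_ler_powR; rewrite ?oppr_ge0 ?nnegrE ?(ltW x0) ?(ltW y0).
by rewrite !powRN lef_pV2 ?posrE ?powR_gt0.
Qed.

(** The intermediate points for second differences lie between N and 6 * N, whence 6 ^ (c - 2) in
    the lower constant. First differences are at most c * (5 * N) ^ (c - 1) <= 2 * 5 * N ^ (c - 1),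
    whence 10. *)
Lemma growth_powR c (N : nat) : 1 < c -> c < 2 -> (0 < N)%N ->
  growth (fun n => n%:R `^ c) N (c * (c - 1) * 6 `^ (c - 2)) 10 (N%:R `^ (c - 2)).
Proof.
move=> c1 c2 N0; have x0 : 0 < N%:R :> R by rewrite ltr0n.
have cc : 0 < c * (c - 1) by rewrite mulr_gt0; lra.
split.
- by rewrite mulr_gt0 // powR_gt0.
- by rewrite ler1n.
- exact: powR_gt0.
- by move=> n; apply: powR_ge0.
- move=> n /andP[Nn n4].
  have n0 : 0 < n%:R :> R by rewrite ltr0n; apply: leq_trans Nn.
  have [x /andP[nx xn] ->] := powR_MVT c n0 (ltac:(rewrite -natr1; lra) : n%:R < n.+1%:R :> R).
  rewrite -natr1 (_ : n%:R + 1 - n%:R = 1 :> R); last by ring.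
  have xp : 0 < x by lra.
  rewrite mulr1 mulr_ge0 ?powR_ge0 //=; last by lra.
  rewrite (_ : N%:R * N%:R `^ (c - 2) = N%:R `^ (c - 1)); last first.
    have -> : c - 2 = (c - 1) - 1 by ring.
    by rewrite mulr_powRB1 ?(ltW x0) //; lra.
  apply: le_trans (_ : 2 * (5 * N%:R) `^ (c - 1) <= _).
    apply: ler_pM; rewrite ?powR_ge0 //; try lra.
    apply: ge0_ler_powR; rewrite ?nnegrE ?mulr_ge0 //; try lra.
    have : (n.+1 <= 5 * N)%N by clear -n4 N0; lia.
    by rewrite -(ler_nat R) natrM; lra.
  rewrite powRM ?ler0n // mulrA; apply: ler_wpM2r; first exact: powR_ge0.
  have -> : 10 = 2 * 5 :> R by ring.
  rewrite ler_pM2l // -[leRHS](@powRr1 R 5) //; apply: ler_powR; last by lra.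
  by rewrite ler1n.
- move=> n /andP[Nn n4].
  have n0 : 0 < n%:R :> R by rewrite ltr0n; apply: leq_trans Nn.
  have [x /andP[nx xn]] := powR_diff2_MVT c n0.
  rewrite -[2]/(2%:R) -natrD -[1]/(1%:R) -natrD addn1 addn2 => ->.
  have Nx : N%:R <= x by apply: le_trans (ltW nx); rewrite ler_nat.
  have xN : x <= 6 * N%:R.
    apply: le_trans (ltW xn) _; rewrite -natrD -natrM ler_nat.
    by clear -n4 N0; lia.
  have xp : 0 < x by lra.
  have s0 : c - 2 <= 0 by lra.
  apply/andP; split.
    rewrite -[leLHS]mulrA ler_pM2l // -powRM ?ler0n //.
    exact: le_powR_exp_neg.
  apply: ler_pM; rewrite ?powR_ge0 ?(ltW cc) //.
    apply: le_trans (_ : 2 * (c - 1) <= _); first by rewrite ler_wpM2r; lra.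
    lra.
  exact: le_powR_exp_neg.
Qed.

End PowerGrowth.

(** * Correlations of the Thue-Morse sign along the floors of n ^ c *)

Lemma sum_of_digits2_widen n B : (n <= B)%N ->
  sum_of_digits2 n = (\sum_(0 <= i < B) odd (n %/ 2 ^ i))%N.
Proof.
move=> nB; rewrite /sum_of_digits2 -(big_mkord xpredT (fun i => nat_of_bool (odd (n %/ 2 ^ i)))).
rewrite [RHS](@big_cat_nat _ _ _ n) //= [X in (_ + X)%N](_ : _ = 0)%N ?addn0 //.
rewrite big_nat big1 // => i /andP[ni _].
by rewrite divn_small // (leq_ltn_trans ni) // ltn_expl.
Qed.

Lemma thue_morse_double (b : bool) n : thue_morse (b + n.*2) = b (+) thue_morse n.
Proof.
rewrite /thue_morse (@sum_of_digits2_widen _ (b + n.*2).+1) // (@sum_of_digits2_widen n (b + n.*2)%N).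
  rewrite big_nat_recl //= expn0 divn1 oddD oddb oddD odd_double addbF oddb; congr (_ (+) odd _).
  apply: eq_bigr => i _; rewrite expnS divnMA.
  by rewrite divn2 half_bit_double.
by rewrite -addnn addnA leq_addl.
Qed.

Lemma uphalf_bounds N : (1 < N)%N ->
  [/\ 0 < uphalf N, uphalf N < N, 3 * uphalf N <= 2 * N & N - uphalf N <= uphalf N]%N.
Proof. by move=> N1; split; lia. Qed.

Section ThueMorse.
Variable R : realType.

Definition tm_sign (n : nat) : R := (-1) ^+ thue_morse n.

Lemma tm_sign0 : tm_sign 0 = 1.
Proof. by rewrite /tm_sign /thue_morse /sum_of_digits2 big_ord0. Qed.

Lemma tm_sign_double n : tm_sign n.*2 = tm_sign n.
Proof. by rewrite /tm_sign -[n.*2]add0n (thue_morse_double false). Qed.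

Lemma tm_sign_doubleS n : tm_sign n.*2.+1 = - tm_sign n.
Proof. by rewrite /tm_sign -[n.*2.+1]add1n (thue_morse_double true) signr_addb mulN1r. Qed.

Variables (c : R) (L : nat) (I : seq nat).
Hypotheses (c_gt1 : 1 < c) (c_lt : c < 3 / 2).
Hypotheses (uI : uniq I) (IL : all (fun i => i < L)%N I) (I0 : (0 < size I)%N).

Let g (n : nat) : R := n%:R `^ c.
Let corr := correlation tm_sign g I.

Lemma corr_norm n : `|corr n| = 1.
Proof. exact: (prod_sign_norm tm_sign0 tm_sign_double tm_sign_doubleS). Qed.

Lemma sum_corr_trivial A B : `|\sum_(A <= n < B) corr n| <= (B - A)%:R.
Proof.
apply: le_trans (ler_norm_sum _ _ _) _; rewrite -[leRHS](_ : \sum_(A <= n < B) 1 = _).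
  by apply: ler_sum => n _; rewrite corr_norm.
by rewrite sumr_const_nat.
Qed.

(** [correlation_bound] with q = 2 ^ rho chosen within a factor 2 of N ^ (1 / P). *)
Lemma sum_corr_dyadic : exists (P : nat) (C : R), [/\ (1 < P)%N, 0 <= C &
  forall N Y, (0 < N)%N -> (Y <= N)%N ->
    `|\sum_(N <= n < N + Y) corr n| <= C * N%:R `^ (1 - P%:R^-1)].
Proof.
have [B [C HC]] := correlation_bound tm_sign0 tm_sign_double tm_sign_doubleS uI IL I0
  (c * (c - 1) * 6 `^ (c - 2)) 10.
have [hc1 hc2] := (c_gt1, c_lt).
have d1 : 0 < c - 1 by lra.
have d2 : 0 < 3 - 2 * c by lra.
(* P makes B / P <= c - 1 and 13 / P <= 3 - 2 * c. For q <= N ^ (1 / P) and E = N ^ (c - 2) these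
   give q ^ B <= N * E and N * E ^ 2 * q ^ 13 <= 1. *)
pose P := (Num.truncn (B%:R / (c - 1)) + Num.truncn (13 / (3 - 2 * c)) + 3)%N.
have P2 : (1 < P)%N by rewrite /P addnC.
have P0 : 0 < P%:R :> R by rewrite ltr0n ltnW.
have PB : B%:R / P%:R <= c - 1.
  rewrite ler_pdivrMr // mulrC -ler_pdivrMr //; apply: le_trans (ltW (truncnS_gt _)) _.
  by rewrite ler_nat /P; move: (Num.truncn (B%:R / _)) (Num.truncn (13 / _)); clear; lia.
have P13 : 13 / P%:R <= 3 - 2 * c.
  rewrite ler_pdivrMr // mulrC -ler_pdivrMr //; apply: le_trans (ltW (truncnS_gt _)) _.
  by rewrite ler_nat /P; move: (Num.truncn (B%:R / _)) (Num.truncn (13 / _)); clear; lia.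
have Pinv : P%:R^-1 <= 2^-1 :> R by rewrite lef_pV2 ?posrE // ler_nat.
have Pinv0 : 0 < P%:R^-1 :> R by rewrite invr_gt0.
(* The factor 2 allows for q being only half of N ^ (1 / P); 2 ^ (5 * P) covers trivially the N with
   rho < 5, for which 2 * 10 <= 2 ^ rho fails. *)
exists P, (2 * `|C| + 2 ^+ (5 * P)); split=> //.
move=> N Y N0 YN; pose x : R := N%:R.
have x1 : 1 <= x by rewrite ler1n.
have x0 : 0 < x by lra.
pose y := x `^ P%:R^-1.
have yX n : y ^+ n = x `^ (n%:R / P%:R).
  by rewrite -powR_mulrn ?powR_ge0 // -powRrM mulrC.
have yP : y ^+ P = x by rewrite yX divff ?gt_eqF // powRr1 // ltW.
have y0 : 0 < y by rewrite powR_gt0.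
have xy : x `^ (1 - P%:R^-1) = x / y.
  by rewrite powRB ?powRr1 ?(ltW x0) // (gt_eqF x0) implybT.
have xpow1 : 1 <= x `^ (1 - P%:R^-1).
  by rewrite -[leLHS](powRr0 x); apply: ler_powR => //; lra.
set l := trunc_log 2 N; pose rho := (l %/ P)%N.
have /andP[l1 l2] := trunc_log_bounds (isT : 1 < 2)%N N0; rewrite -/l in l1 l2.
have rl : (rho * P <= l)%N by exact: leq_trunc_div.
have lr : (l.+1 <= rho.+1 * P)%N by rewrite ltn_ceil // ltnW.
have qP : (2 ^+ rho) ^+ P <= x :> R.
  by rewrite -exprM -natrX ler_nat; apply: leq_trans l1; rewrite leq_exp2l.
have q2P : x <= (2 ^+ rho.+1) ^+ P.
  by rewrite -exprM -natrX ler_nat; apply: leq_trans (ltnW l2) _; rewrite leq_exp2l.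
have qy : 2 ^+ rho <= y.
  by move: qP; rewrite -yP ler_pXn2r ?nnegrE ?exprn_ge0 ?(ltW y0) // ltnW.
have yq : y <= 2 ^+ rho.+1.
  by move: q2P; rewrite -yP ler_pXn2r ?nnegrE ?exprn_ge0 ?(ltW y0) // ltnW.
rewrite mulrDl; case: (ltnP rho 5) => rho5.
  have N5 : x <= 2 ^+ (5 * P).
    by apply: le_trans q2P _; rewrite -exprM ler_weXn2l ?ler1n // leq_mul2r rho5 orbT.
  apply: le_trans (sum_corr_trivial _ _) _; rewrite addKn.
  apply: (@le_trans _ _ x); first by rewrite ler_nat.
  apply: le_trans N5 _; rewrite -[leLHS]add0r; apply: lerD.
    by rewrite !mulr_ge0 // powR_ge0.
  by apply: ler_peMr => //; rewrite exprn_ge0.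
have q0 : 0 < 2 ^+ rho :> R by rewrite exprn_gt0.
have xE : x * x `^ (c - 2) = x `^ (c - 1).
  have -> : c - 2 = (c - 1) - 1 by ring.
  by rewrite mulr_powRB1 ?(ltW x0).
have rho0 : (0 < rho)%N by apply: leq_trans rho5.
have c2 : c < 2 by lra.
have := HC g N (x `^ (c - 2)) rho (growth_powR c_gt1 c2 N0) rho0.
have h10 : 2 * 10 <= 2 ^+ rho :> R.
  apply: (@le_trans _ _ (2 ^+ 5)); last by rewrite ler_weXn2l ?ler1n.
  by rewrite -natrM -natrX ler_nat.
have hB : (2 ^+ rho) ^+ B <= N%:R * x `^ (c - 2) :> R.
  rewrite -/x xE; apply: le_trans (_ : y ^+ B <= _).
    by rewrite lerXn2r // nnegrE ?exprn_ge0 // ltW.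
  by rewrite yX; apply: ler_powR.
have h13 : N%:R * (x `^ (c - 2)) ^+ 2 * (2 ^+ rho) ^+ 13 <= 1 :> R.
  apply: le_trans (_ : x * (x `^ (c - 2)) ^+ 2 * y ^+ 13 <= _).
    rewrite ler_wpM2l ?mulr_ge0 ?exprn_ge0 ?powR_ge0 //.
    by rewrite lerXn2r // nnegrE ?exprn_ge0 // ltW.
  rewrite expr2 mulrA xE yX -!powRD; try by rewrite (gt_eqF x0) implybT.
  by rewrite -[leRHS](powRr0 x); apply: ler_powR => //; lra.
move=> /(_ h10 hB h13 Y YN) H; apply: le_trans H _.
apply: le_trans (_ : `|C| * (x / 2 ^+ rho) <= _).
  by apply: ler_wpM2r; rewrite ?ler_norm // divr_ge0 // ltW.
apply: le_trans (_ : 2 * `|C| * x `^ (1 - P%:R^-1) <= _); last first.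
  by rewrite lerDl mulr_ge0 ?exprn_ge0 ?powR_ge0.
have -> : 2 * `|C| * x `^ (1 - P%:R^-1) = `|C| * (x * (2 / y)) by rewrite xy; ring.
rewrite ler_wpM2l // ler_wpM2l ?(ltW x0) //.
rewrite ler_pdivlMr // mulrC ler_pdivrMr //.
by move: yq; rewrite exprS.
Qed.

(** Strong induction: the range is cut at the rounded-up half M of N, and [M, N) is a partial dyadic
    sum since N - M <= M. *)
Lemma sum_corr_le : exists (eta C : R), [/\ 0 < eta, 0 <= C &
  forall N, (0 < N)%N -> `|\sum_(0 <= n < N) corr n| <= C * N%:R `^ (1 - eta)].
Proof.
have [P [C [P1 C0 HC]]] := sum_corr_dyadic.
have P0 : 0 < P%:R :> R by rewrite ltr0n ltnW.
have Pinv : P%:R^-1 <= 2^-1 :> R by rewrite lef_pV2 ?posrE // ler_nat.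
have Pinv0 : 0 < P%:R^-1 :> R by rewrite invr_gt0.
pose e : R := 1 - P%:R^-1; have e0 : 0 < e by rewrite /e; lra.
have ee : P%:R^-1 = 1 - e by rewrite /e; ring.
(* M is at most 2 * N / 3 for N > 1, so M ^ e <= r * N ^ e with r < 1. *)
pose r : R := (2 / 3) `^ e.
have r1 : r < 1.
  by have := @gt0_ltr_powR R e e0 (2 / 3) 1; rewrite powR1 !nnegrE; apply; lra.
have r0 : 0 <= r by exact: powR_ge0.
(* With this choice (D + C) * r = D - 1 + r <= D closes the induction; the summand 1 covers N =
   1. *)
pose D := C * r / (1 - r) + 1.
have D0 : 0 <= D by rewrite addr_ge0 // divr_ge0 ?mulr_ge0 //; lra.
exists P%:R^-1, D; split=> //; rewrite -/e.
elim/ltn_ind => N IH N0.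
case: (leqP N 1) => [N1|N1].
  have -> : N = 1%N by apply/eqP; rewrite eqn_leq N1.
  apply: le_trans (sum_corr_trivial _ _) _; rewrite subn0 powR1 mulr1.
  by rewrite lerDr divr_ge0 ?mulr_ge0 //; lra.
pose M := uphalf N.
have [M0 MN M3 YM] := uphalf_bounds N1; rewrite -/M in M0 MN M3 YM.
rewrite (@big_cat_nat _ _ _ M) //=; last exact: ltnW.
apply: le_trans (ler_normD _ _) _.
have := HC M (N - M)%N M0 YM; rewrite subnKC ?(ltnW MN) // -/e => h2.
apply: le_trans (lerD (IH M MN M0) h2) _; rewrite -mulrDl.
have Mr : M%:R `^ e <= r * N%:R `^ e.
  rewrite /r -powRM //.
  apply: ge0_ler_powR; rewrite ?nnegrE ?mulr_ge0 ?(ltW e0) //; try lra.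
  by have : (3 * M)%:R <= (2 * N)%:R :> R; [rewrite ler_nat | rewrite !natrM; lra].
apply: le_trans (_ : (D + C) * (r * N%:R `^ e) <= _).
  by rewrite ler_wpM2l // addr_ge0.
rewrite mulrA ler_wpM2r ?powR_ge0 //.
have -> : (D + C) * r = C * r / (1 - r) + r by rewrite /D; field; lra.
by rewrite /D lerD2l ltW.
Qed.

End ThueMorse.

(** * From correlations to frequencies of windows *)

Section Discrepancy.
Variables (R : realType) (c : R) (L : nat).
Hypotheses (c_gt1 : 1 < c) (c_lt : c < 3 / 2).

Let g (n : nat) : R := n%:R `^ c.
Let u := thue_morse_PS c.
Let shifts (J : {set 'I_L}) : seq nat := [seq val i | i <- enum J].
Let weight (w : L.-tuple bool) (J : {set 'I_L}) : R := \prod_(i in J) (-1) ^+ tnth w i.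

Lemma count_belowE (A : pred nat) N : (count_below A N)%:R = \sum_(0 <= n < N) (A n)%:R :> R.
Proof.
rewrite /count_below -sum1_card natr_sum big_mkcond big_mkord.
by apply: eq_bigr => i _; rewrite inE; case: (A i).
Qed.

(** The sign F i is 1 exactly when coordinate i agrees with w, so the indicator is the product of
    the factors (F i + 1) / 2, expanded over subsets J of coordinates. *)
Lemma window_indicator n (w : L.-tuple bool) :
  (window u L n == w)%:R = (2 ^+ L)^-1 *
    \sum_(J : {set 'I_L}) weight w J * correlation (tm_sign R) g (shifts J) n.
Proof.
pose F (i : 'I_L) : R := (-1) ^+ tnth w i * tm_sign R (Num.truncn (g (n + i)%N)).
have -> : \sum_(J : {set 'I_L}) weight w J * correlation (tm_sign R) g (shifts J) n =
    \prod_i (F i + 1).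
  rewrite bigA_distr; apply: eq_bigr => J _.
  rewrite -big_mkcond /= big_split /= /weight /correlation /shifts big_map.
  by rewrite big_enum.
have FE i : F i + 1 = 2 * (tnth (window u L n) i == tnth w i)%:R.
  rewrite tnth_mktuple /F /tm_sign /u /thue_morse_PS -/(g _).
  by case: (thue_morse _); case: (tnth w i); rewrite /= ?expr0 ?expr1; ring.
rewrite (eq_bigr _ (fun i _ => FE i)) big_split /= prodr_const card_ord mulKf ?gt_eqF ?exprn_gt0 //.
rewrite eqEtuple; case: forallP => [e|/forallP].
  by rewrite big1 // => i _; rewrite e.
by rewrite negb_forall => /existsP[i /negPf ne]; rewrite (bigD1 i) //= ne mul0r.
Qed.

(** The empty set of shifts contributes the main term N / 2 ^ L; every other set has a power saving,
    and the worst of these finitely many exponents is taken. *)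
Lemma window_count_le : exists (eta C : R), [/\ 0 < eta, eta <= 1, 0 <= C &
  forall N, (0 < N)%N -> forall w : L.-tuple bool,
  `|(count_below (fun n => window u L n == w) N)%:R - N%:R / 2 ^+ L| <= C * N%:R `^ (1 - eta)].
Proof.
have exJ (J : {set 'I_L}) : exists p : R * R, J != finset.set0 -> [/\ 0 < p.1, 0 <= p.2 &
    forall N, (0 < N)%N ->
      `|\sum_(0 <= n < N) correlation (tm_sign R) g (shifts J) n| <= p.2 * N%:R `^ (1 - p.1)].
  (* The pair (0, 0) is a placeholder at the empty set, for which nothing is claimed. *)
  case: (altP (J =P finset.set0)) => [->|J0]; first by exists (0, 0).
  have uJ : uniq (shifts J) by rewrite map_inj_uniq ?enum_uniq //; apply: val_inj.
  have JL : all (fun i => i < L)%N (shifts J).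
    by apply/allP => i /mapP[j _ ->]; apply: ltn_ord.
  have sJ : (0 < size (shifts J))%N by rewrite size_map -cardE card_gt0.
  have [eta [C H]] := sum_corr_le c_gt1 c_lt uJ JL sJ.
  by exists (eta, C).
have [h Hh] := choice exJ.
pose eta := \big[Num.min/1]_(J : {set 'I_L} | J != finset.set0) (h J).1.
pose C := (2 ^+ L)^-1 * \sum_(J : {set 'I_L} | J != finset.set0) (h J).2.
have C0 : 0 <= C.
  by rewrite mulr_ge0 ?invr_ge0 ?exprn_ge0 // sumr_ge0 // => J /Hh[].
exists eta, C; split => //.
- by apply: lt_bigmin => // J /Hh[].
- exact: bigmin_le_id.
move=> N N0 w.
rewrite count_belowE; under eq_bigr => n _ do rewrite window_indicator.
rewrite -mulr_sumr exchange_big /= (bigD1 finset.set0) //=.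
have -> : \sum_(0 <= n < N) weight w finset.set0 * correlation (tm_sign R) g (shifts finset.set0) n = N%:R.
  rewrite (eq_bigr (fun=> 1)) ?sumr_const_nat ?subn0 // => n _.
  by rewrite /weight big_set0 /correlation /shifts enum_set0 big_nil mulr1.
rewrite mulrDr [N%:R / _]mulrC addrAC subrr add0r normrM ger0_norm ?invr_ge0 ?exprn_ge0 //.
rewrite /C -mulrA ler_wpM2l ?invr_ge0 ?exprn_ge0 // mulr_suml.
apply: le_trans (ler_norm_sum _ _ _) _; apply: ler_sum => J J0.
have [h1 h2 h3] := Hh J J0.
rewrite -mulr_sumr normrM.
have -> : `|weight w J| = 1.
  by rewrite normr_prod big1 // => i _; rewrite normrX normrN1 expr1n.
rewrite mul1r; apply: le_trans (h3 N N0) _.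
rewrite ler_wpM2l //; apply: ler_powR; first by rewrite ler1n.
by rewrite lerD2l lerN2; apply: bigmin_le_cond.
Qed.

Lemma density_of_power_saving (A : pred nat) (d eta C : R) : 0 < eta ->
  (forall N, (0 < N)%N -> `|(count_below A N)%:R - N%:R * d| <= C * N%:R `^ (1 - eta)) ->
  has_density A d.
Proof.
move=> eta0 H; apply/cvgrPdist_lt => e e0.
(* Beyond this threshold e * N ^ eta exceeds |C| + 1, so the error divided by N is below e; the
   summand 1 keeps the base positive when C = 0. *)
pose B := ((`|C| + 1) / e) `^ eta^-1.
exists (Num.truncn B).+1 => // N /= BN.
have N0 : (0 < N)%N by apply: leq_ltn_trans BN.
have x0 : 0 < N%:R :> R by rewrite ltr0n.
have BNR : B < N%:R by apply: lt_le_trans (truncnS_gt _) _; rewrite ler_nat.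
have Ce : 0 < (`|C| + 1) / e by rewrite divr_gt0 // ltr_wpDl.
have Neta : (`|C| + 1) / e < N%:R `^ eta.
  have := @gt0_ltr_powR R eta eta0 B N%:R; rewrite !nnegrE powR_ge0 ler0n => /(_ isT isT BNR).
  by rewrite /B -powRrM mulVf ?gt_eqF // powRr1 // ltW.
have y0 : 0 < N%:R `^ eta by rewrite powR_gt0.
rewrite distrC -(ltr_pM2r x0) -{2}(ger0_norm (ltW x0)) -normrM mulrBl divfK ?gt_eqF // [d * _]mulrC.
apply: le_lt_trans (H N N0) _.
rewrite powRB ?powRr1 ?(ltW x0) //; last by rewrite (gt_eqF x0) implybT.
rewrite mulrA ltr_pdivrMr // [e * _]mulrC -mulrA [C * _]mulrC ltr_pM2l //.
apply: le_lt_trans (ler_norm C) _.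
rewrite ltr_pdivrMr // [_ * e]mulrC in Neta.
by apply: lt_trans Neta; rewrite ltrDl.
Qed.
End Discrepancy.

Theorem theorem1 (R : realType) (c : R) (hc1 : 1 < c) (hc2 : c < 3 / 2) :
  normal_seq R (thue_morse_PS c) /\
  (forall L : nat, (1 <= L)%N ->
    exists eta C : R, 0 < eta /\
      forall N : nat, (1 <= N)%N -> forall w : L.-tuple bool,
        `| (count_below (fun n => window (thue_morse_PS c) L n == w) N)%:R
           - N%:R / 2 ^+ L : R| <= C * N%:R `^ (1 - eta)).
Proof.
split=> [L L1 w|L L1].
  have [eta [C [eta0 _ _ H]]] := window_count_le L hc1 hc2.
  by apply: (density_of_power_saving eta0) => N N0; apply: H.
have [eta [C [eta0 _ _ H]]] := window_count_le L hc1 hc2.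
by exists eta, C.
Qed.
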